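(* Let $G$ be an unmixed bipartite graph with $n$ vertices and without isolated vertices. Let $\mathcal{A}=\{v_1,\ldots,v_q\}\subset\{0,1\}^n$ be the set of column vectors of the clutter matrix of the blocker $\Upsilon(G)$ of $G$, let $P=\mathrm{conv}(\mathcal{A})$, let $K$ be a field, and let $A(P)$ be the Ehrhart ring of $P$ over $K$. Then the blocker of $G$ is an Ehrhart clutter and the Castelnuovo-Mumford regularity of $A(P)$ is sharply bounded from above by $(n/2)-1$.
   Context: A clutter on a finite vertex set $X=\{x_1,\ldots,x_n\}$ is a family of subsets of $X$ (the edges), none of which is contained in another; a graph is regarded as a clutter whose edges are its usual edges. The characteristic vector of a subset $e\subset X$ is $\sum_{x_i\in e}e_i\in\{0,1\}^n$, with $e_i$ the $i$-th unit vector; the clutter matrix of a clutter is the matrix whose columns are the characteristic vectors of its edges. A vertex cover is a subset of $X$ meeting every edge. A graph is unmixed if all its inclusion-minimal vertex covers have the same size. The blocker $\Upsilon(G)$ of $G$ is the clutter on $V(G)$ whose edges are the inclusion-minimal vertex covers of $G$. Let $R=K[x_1,\ldots,x_n]$, let $t$ be a new variable, and write $x^a=x_1^{a_1}\cdots x_n^{a_n}$. The Ehrhart ring of $P$ is the $K$-subalgebra $A(P)=K[\{x^at^b\mid b\in\mathbb{N},\ a\in bP\cap\mathbb{Z}^n\}]$ of $R[t]$, graded by $\deg(x^at^b)=b$. The clutter whose edges have characteristic vectors $v_1,\ldots,v_q$ is called Ehrhart if $K[x^{v_1}t,\ldots,x^{v_q}t]=A(P)$; equivalently, $\mathcal{H}=\{(v_1,1),\ldots,(v_q,1)\}\subset\mathbb{Z}^{n+1}$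 is a Hilbert basis, meaning $\mathbb{N}\mathcal{H}=\mathbb{R}_+\mathcal{H}\cap\mathbb{Z}^{n+1}$, where $\mathbb{N}\mathcal{H}$ and $\mathbb{R}_+\mathcal{H}$ are the non-negative integer span and the non-negative real span of $\mathcal{H}$. For a homogeneous subring $S=K[x^{v_1}t,\ldots,x^{v_q}t]$ with the grading given by $\deg(x^at^b)=b$, presented as $K[t_1,\ldots,t_q]/I\cong S$ via $\overline{t}_i\mapsto x^{v_i}t$, let $\mathbb{F}_\star$ be the minimal graded free resolution of $S$ over $K[t_1,\ldots,t_q]$; the Castelnuovo-Mumford regularity is $\mathrm{reg}(S)=\max_j\{b_j-j\}$, where $b_j$ is the maximum of the degrees of a minimal set of generators of the $j$-th free module $F_j$. It is applied to $A(P)$ through the equality $A(P)=K[x^{v_1}t,\ldots,x^{v_q}t]$. *)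

(* Defs.v *)
From HB Require Import structures.
From mathcomp Require Import all_boot all_order all_algebra.
From mathcomp Require Import reals.
From mathcomp Require Import mpoly.

Set Implicit Arguments.
Unset Strict Implicit.
Unset Printing Implicit Defensive.

Import Order.TTheory GRing.Theory Num.Theory.
Local Open Scope ring_scope.

(* Clutters and graphs on {x_1, ..., x_n} are given by their sets of edges, as
   sets of subsets of 'I_n. A family of two-element sets is always a clutter. *)

Definition is_clutter n (C : {set {set 'I_n}}) : Prop :=
  forall e f, e \in C -> f \in C -> e \subset f -> e = f.

Definition is_graph n (G : {set {set 'I_n}}) : Prop :=
  forall e, e \in G -> #|e| = 2%N.

Definition bipartite n (G : {set {set 'I_n}}) : Prop :=
  exists A : {set 'I_n}, forall e, e \in G ->
    exists x y, [/\ x \in A, y \notin A & e = [set x; y]].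

Definition no_isolated_vertex n (G : {set {set 'I_n}}) : Prop :=
  forall x : 'I_n, exists2 e, e \in G & x \in e.

Definition vertex_cover n (G : {set {set 'I_n}}) (C : {set 'I_n}) : bool :=
  [forall e in G, C :&: e != set0].

Definition blocker n (G : {set {set 'I_n}}) : {set {set 'I_n}} :=
  [set C | minset (vertex_cover G) C].

Definition unmixed n (G : {set {set 'I_n}}) : Prop :=
  forall C D, C \in blocker G -> D \in blocker G -> #|C| = #|D|.

Definition clutter_mx n (C : {set {set 'I_n}}) : 'M[nat]_(n, #|C|) :=
  \matrix_(i < n, j < #|C|) (i \in (enum_val j : {set 'I_n}) : nat).

Definition clutter_col n (C : {set {set 'I_n}}) (j : 'I_#|C|) : 'X_{1..n} :=
  [multinom clutter_mx C i j | i < n].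
Arguments clutter_col {n} C j.

Definition real_vec (R : realType) n (a : 'X_{1..n}) : 'rV[R]_n :=
  \row_i (a i)%:R.

Definition conv (R : realType) n q (v : 'I_q -> 'rV[R]_n) (p : 'rV[R]_n) : Prop :=
  exists l : 'I_q -> R,
    [/\ forall j, 0 <= l j, \sum_j l j = 1 & p = \sum_j l j *: v j].

Definition clutter_polytope (R : realType) n (C : {set {set 'I_n}}) :
    'rV[R]_n -> Prop :=
  conv (fun j => real_vec R (clutter_col C j)).
Arguments clutter_polytope R {n} C _.

(* K[x_1, ..., x_n][t] is modelled as {poly {mpoly K[n]}}, with t = 'X; xt_mon
   is x^a t^b. *)

Definition xt_mon (K : fieldType) n (a : 'X_{1..n}) (b : nat) :
    {poly {mpoly K[n]}} :=
  'X_[a] *: 'X^b.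

Inductive subalgebra_gen (K : fieldType) n (F : {poly {mpoly K[n]}} -> Prop) :
    {poly {mpoly K[n]}} -> Prop :=
| subalg_gen f of F f : subalgebra_gen F f
| subalg_const (c : K) : subalgebra_gen F c%:MP%:P
| subalg_add f g of subalgebra_gen F f & subalgebra_gen F g :
    subalgebra_gen F (f + g)
| subalg_mul f g of subalgebra_gen F f & subalgebra_gen F g :
    subalgebra_gen F (f * g).

(* Only lattice points with nonnegative coordinates are considered: this loses
   nothing for polytopes contained in the nonnegative orthant, which is
   required anyway for x^a to belong to K[x_1, ..., x_n]. *)
Definition ehrhart_ring (R : realType) (K : fieldType) n (P : 'rV[R]_n -> Prop) :
    {poly {mpoly K[n]}} -> Prop :=
  subalgebra_gen (fun f => exists (a : 'X_{1..n}) (b : nat),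
    (exists2 p, P p & real_vec R a = b%:R *: p) /\ f = xt_mon K a b).
Arguments ehrhart_ring {R} K {n} P _.

Definition edge_subring (K : fieldType) n (C : {set {set 'I_n}}) :
    {poly {mpoly K[n]}} -> Prop :=
  subalgebra_gen (fun f => exists j : 'I_#|C|, f = xt_mon K (clutter_col C j) 1).
Arguments edge_subring K {n} C _.

Definition ehrhart_clutter (R : realType) (K : fieldType) n
    (C : {set {set 'I_n}}) : Prop :=
  is_clutter C /\
  forall f, edge_subring K C f
            <-> ehrhart_ring K (clutter_polytope R C) f.

Section Regularity.
Variables (K : fieldType) (n q : nat) (v : 'I_q -> 'X_{1..n}).

Local Notation T := {mpoly K[q]}.
Local Notation Rt := {poly {mpoly K[n]}}.

(* The K-algebra morphism t_j |-> x^{v_j} t, through which K[t_1, ..., t_q]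
   acts on Rt. *)
Definition toric_map : T -> Rt :=
  mmap (polyC \o @mpolyC n K) (fun j => xt_mon K (v j) 1).

(* Data of a complex ... -> F_1 -> F_0 -> Rt with
   F_j = (+)_(i < rk j) T(- shift j i), whose elements are row vectors. The
   map F_(j+1) -> F_j is u |-> u *m diff j, and aug lists the images in Rt
   of the basis of F_0. The shifts occurring in a minimal resolution of a
   submodule of Rt are nonnegative, since Rt is nonnegatively graded. *)
Record free_complex := FreeComplex {
  rk : nat -> nat;
  shift : forall j, 'I_(rk j) -> nat;
  aug : 'I_(rk 0) -> Rt;
  diff : forall j, 'M[T]_(rk j.+1, rk j) }.

Definition augment (F : free_complex) (u : 'rV[T]_(rk F 0)) : Rt :=
  \sum_i toric_map (u 0 i) * aug i.

(* Rt is graded by deg (x^a t^b) = b, and the t_j have degree 1. *)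
Definition graded (F : free_complex) : Prop :=
  (forall i, exists g : {mpoly K[n]}, @aug F i = g *: 'X^(shift i)) /\
  (forall j i k, diff F j i k != 0 ->
     exists2 d, shift i = (shift k + d)%N & diff F j i k \is d.-homog).

Definition resolves (S : Rt -> Prop) (F : free_complex) : Prop :=
  [/\ forall s, S s <-> exists u : 'rV[T]_(rk F 0), augment u = s,
      forall u : 'rV[T]_(rk F 0),
        augment u = 0 <-> exists w, u = w *m diff F 0
    & forall j (u : 'rV[T]_(rk F j.+1)),
        u *m diff F j = 0 <-> exists w, u = w *m diff F j.+1].

(* The image of F_(j+1) lies in (t_1, ..., t_q) F_j. *)
Definition minimal (F : free_complex) : Prop :=
  forall j i k, (diff F j i k)@_0%MM = 0.

Definition minimal_graded_free_resolution (S : Rt -> Prop) (F : free_complex) :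
    Prop :=
  [/\ graded F, resolves S F & minimal F].

(* r = max_j (b_j - j), where b_j is the largest shift in F_j; the indices j
   with F_j = 0 do not contribute. *)
Definition is_regularity (S : Rt -> Prop) (r : int) : Prop :=
  exists F, [/\ minimal_graded_free_resolution S F,
    exists j (i : 'I_(rk F j)), r = (shift i)%:Z - j%:Z
    & forall j (i : 'I_(rk F j)), (shift i)%:Z - j%:Z <= r].

End Regularity.

(* Main.v *)
Require Import Defs.
From HB Require Import structures.
From mathcomp Require Import all_boot all_order all_algebra.
From mathcomp Require Import boolp reals.
From mathcomp Require Import mpoly zify ring.

Set Implicit Arguments.
Unset Strict Implicit.
Unset Printing Implicit Defensive.

Import Order.TTheory GRing.Theory Num.Theory.
Local Open Scope ring_scope.

(** An unmixed bipartite graph without isolated vertices has two sides [X] and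
its complement that are both minimal covers, hence of the same size [g = n/2].
For [S] inside [X], the set [X \ S] together with the neighbours of [S] is a
cover, so it has at least [g] elements: this is Hall's condition, and there is
a perfect matching [mu]. A minimal cover has [g] elements and meets all the [g]
matched edges, so it contains exactly one end of each ([unmixed_matching]). It
is thus determined by its trace on [X], and the traces are the subsets of [X]
closed under the relation [r x w], meaning that [x] is adjacent to [mu w]: the
covers form a distributive lattice, and [K[x^(v_1) t, ..., x^(v_q) t]] is its
Hibi ring.

The lattice points [(a, b)] of the cone over the covers are those such that
[a x + a (mu x) = b], [a >= 0], and [a w <= a x] whenever [r x w]. The level
set where [a > 0] is closed, and subtracting the corresponding cover leaves a
point of level [b - 1] of the cone; so every point of the cone is a sum of
covers ([coneE]), which is the Ehrhart property ([ehrhart_image]).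

The regularity is read off from Koszul homology, which is multigraded: in
multidegree [al] it is the homology of a complex of scalar functions on the
sets [S] of variables such that [al - \sum_(j in S) v_j] lies in the cone. The
same complex makes sense for any set of points [B] spanning a subquotient of
the ring. For [D] closed in [X], let [face D set0] be the face of the cone
where [a = b] on [D]. The variable of the cover with trace [D] is a nonzero
divisor on it, and unless [D = X] the cokernel is spanned by the union of the
smaller faces [a x = b], [x] in [X \ D]. As the variables act by zero on
Koszul homology, the vanishing of the homology of the cokernel implies that of
the face; and the union is assembled from smaller faces by short exact sequences. Induction
on [#|X \ D|] shows that the [k]-th homology of [face D set0] vanishes in
degrees above [k + #|X \ D| - 1] ([face_regularity]). For [D] empty this bounds
the regularity by [g - 1].

If the graph is a perfect matching, the same induction bounds the homological
degrees ([face_depth]), and with that bound the exact sequences also carry a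
nonzero class in the last homological degree from the smallest face up to the
whole cone ([face_not_acyclic]), where it has degree [k + g - 1]: the bound
[g - 1] is attained.

Finally, Koszul homology controls the minimal resolution. It is built by
choosing minimal homogeneous generators of the successive kernels [Z]. A
vanishing for [F_j / Z_j] passes to [F_(j+1) / Z_(j+1)] by dimension shifting
([shift_down]) and bounds the degrees of the generators of [Z_j]
([decompose_of_quot_acyclic]); as the graded pieces are finite dimensional,
this bound alone makes every [F_j] of finite rank. In the other direction,
small shifts would force vanishing of the Koszul homology of the ring
([shift_up]). Both directions are combined in [toric_regularity]. *)

(** * Koszul chains *)

(** The sign of the exterior variable [i] when it is moved to its place in the
    increasing product over [S] is [(-1) ^+ rank_in i S]. *)
Definition rank_in q (i : 'I_q) (S : {set 'I_q}) : nat :=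
  #|[set j in S | (j < i)%N]|.

Lemma rank_in_add q (i j : 'I_q) (S : {set 'I_q}) : j \notin S ->
  rank_in i (j |: S) = ((j < i) + rank_in i S)%N.
Proof.
move=> jS; rewrite /rank_in; case: ltnP => ji.
- rewrite (_ : [set _ in _ | _] = j |: [set k in S | (k < i)%N]).
    by rewrite cardsU1 inE (negbTE jS).
  by apply/setP => k; rewrite !inE; case: eqP => [->|//]; rewrite ji.
- apply: eq_card => k; rewrite !inE; have [->|//] := eqVneq k j.
  by rewrite ltnNge ji !andbF.
Qed.

Lemma rank_in_D1 q (i : 'I_q) (S : {set 'I_q}) : rank_in i (S :\ i) = rank_in i S.
Proof.
apply: eq_card => k; rewrite !inE; have [->|//] := eqVneq k i.
by rewrite ltnn !andbF.
Qed.

Section Koszul.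
Variables (q : nat) (A : comNzRingType) (x : 'I_q -> A) (V : lmodType A).
Implicit Types (c : {set 'I_q} -> V) (S : {set 'I_q}).

(** The Koszul differential. A chain is a function on the sets of variables,
    the value at [S] being the coefficient of the exterior monomial of [S]; in
    this form chains need no exterior algebra. *)
Definition koszul c S : V :=
  \sum_(i | i \notin S) ((-1) ^+ rank_in i S * x i) *: c (i |: S).

Lemma koszul_ext c c' : c =1 c' -> koszul c =1 koszul c'.
Proof. by move=> cc' S; apply: eq_bigr => i _; rewrite cc'. Qed.

Lemma koszulB c c' S : koszul (fun S => c S - c' S) S = koszul c S - koszul c' S.
Proof. by rewrite -sumrB; apply: eq_bigr => i _; rewrite scalerBr. Qed.

(** Adding [i] then [j], or [j] then [i], to [S] differ by one transposition. *)
Lemma rank_in_swap (R : pzRingType) (i j : 'I_q) S : i \notin S -> j \notin S -> i != j ->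
  (-1) ^+ rank_in i S * (-1) ^+ rank_in j (i |: S)
  = - ((-1) ^+ rank_in j S * (-1) ^+ rank_in i (j |: S)) :> R.
Proof.
move=> iS jS; rewrite !rank_in_add // -!exprD -val_eqE => /= ij.
rewrite -signr_odd -[in RHS]signr_odd !oddD.
case: (ltngtP i j) ij => //= _ _; do 2 case: odd => //=; rewrite ?expr0 ?expr1 ?opprK //.
Qed.

Lemma koszul_koszul c S : koszul (koszul c) S = 0.
Proof.
pose F i j := ((-1) ^+ rank_in i S * x i) *:
   (((-1) ^+ rank_in j (i |: S) * x j) *: c (j |: (i |: S))).
have FE i j : i \notin S -> j \notin S -> i != j -> F i j = - F j i.
  move=> iS jS ij; rewrite /F !scalerA setUCA -scaleNr; congr (_ *: _).
  by rewrite mulrACA rank_in_swap // mulNr [x i * _]mulrC [in RHS]mulrACA.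
have -> : koszul (koszul c) S
    = \sum_(i | i \notin S) \sum_(j | (j \notin S) && (j != i)) F i j.
  apply: eq_bigr => i iS; rewrite scaler_sumr; apply: eq_bigl => j.
  by rewrite !inE negb_or andbC.
have -> : \sum_(i | i \notin S) \sum_(j | (j \notin S) && (j != i)) F i j
  = \sum_(i | i \notin S) \sum_(j | (j \notin S) && (j < i)%N) F i j
    + \sum_(i | i \notin S) \sum_(j | (j \notin S) && (i < j)%N) F i j.
  rewrite -big_split; apply: eq_bigr => i Pi /=.
  rewrite (bigID (fun j : 'I_q => (j < i)%N)) /=; congr (_ + _);
    apply: eq_bigl => j; case: (j \in S) => //=; rewrite -val_eqE /=; lia.
(* the terms with [i < j] cancel those with [j < i] *)
rewrite [X in _ + X](exchange_big_dep (fun i => i \notin S)) /=; last first.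
  by move=> i j _ /andP[].
rewrite -big_split big1 // => i iS /=.
rewrite [X in _ + X](eq_big (fun j => (j \notin S) && (j < i)%N) (fun j => - F i j)) //.
- by rewrite sumrN subrr.
- by move=> j; rewrite iS.
- by move=> j /and3P[jS _ ji]; rewrite FE // -val_eqE /= ltn_eqF.
Qed.

(** Exterior multiplication by the variable [z]: a homotopy between
    multiplication by [x z] and zero. *)
Definition wedge (z : 'I_q) c S : V :=
  if z \in S then (-1) ^+ rank_in z S *: c (S :\ z) else 0.

(** Hence every element of the ideal of the [x z] acts by zero on Koszul
    homology. *)
Lemma koszul_wedge z c S :
  koszul (wedge z c) S + wedge z (koszul c) S = x z *: c S.
Proof.
have sgn2 k : (-1) ^+ k * (-1) ^+ k = 1 :> A.
  by rewrite -exprD addnn -mul2n exprM sqrrN expr1n expr1n.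
rewrite {2}/wedge; case: ifPn => zS; last first.
  rewrite addr0 /koszul (bigD1 z) //= big1 ?addr0 => [|i /andP[iS iz]]; last first.
    by rewrite /wedge !inE eq_sym (negbTE iz) (negbTE zS) scaler0.
  rewrite /wedge !inE eqxx /= setU1K // scalerA mulrAC rank_in_add // ltnn add0n.
  by rewrite sgn2 mul1r.
have zS' : z \notin S :\ z by rewrite !inE eqxx.
rewrite /koszul [X in _ + _ *: X](bigD1 z) //= setD1K // scalerDr addrCA.
rewrite scalerA mulrA rank_in_D1 sgn2 mul1r -[RHS]addr0; congr (_ + _).
rewrite scaler_sumr [X in _ + X](eq_bigl (fun i => i \notin S)); last first.
  by move=> i; rewrite !inE negb_and negbK; have [->|] := eqVneq i z; rewrite ?zS ?andbT.
rewrite -big_split big1 // => i iS /=.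
have iz : i != z by apply: contraNneq iS => ->.
rewrite /wedge !inE zS orbT !scalerA.
have iSz : (i |: S) :\ z = i |: (S :\ z).
  by apply/setP => k; rewrite !inE; have [->|] := eqVneq k z; rewrite // eq_sym (negbTE iz).
rewrite iSz -(rank_in_D1 z (i |: S)) iSz -scalerDl -[RHS](scale0r (c (i |: S :\ z))); congr (_ *: _).
have iS' : i \notin S :\ z by rewrite !inE negb_and iS orbT.
have := rank_in_swap A iS' zS' iz; rewrite setD1K // (rank_in_D1 z S).
have := sgn2 (rank_in i S); have := sgn2 (rank_in i (S :\ z)).
set a := (-1) ^+ rank_in i (S :\ z); set b := (-1) ^+ rank_in z S.
set t := (-1) ^+ rank_in i S; set s := (-1) ^+ rank_in z (i |: _) => aa tt ast.
have -> : s = - (a * b * t) by rewrite -[s]mul1r -aa -mulrA ast mulrN !mulrA.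
have -> : t * x i * - (a * b * t) + b * (a * x i) = (1 - t * t) * (a * b * x i) by ring.
by rewrite tt subrr mul0r.
Qed.

End Koszul.

(** * Koszul homology of one multidegree *)

Section Multigraded.
Variables (K : fieldType) (q : nat) (Gam : zmodType) (v : 'I_q -> Gam).
Implicit Types (B : pred Gam) (S : {set 'I_q}) (al ga : Gam).
Implicit Types (b c : {set 'I_q} -> K^o).

(** In multidegree [al], the coefficient of the exterior monomial of [S] has
    multidegree [cdeg al S]. *)
Definition cdeg al S : Gam := al - \sum_(i in S) v i.

Lemma cdeg_add al i S : i \notin S -> cdeg al S = cdeg al (i |: S) + v i.
Proof. by move=> iS; rewrite /cdeg big_setU1 //= opprD addrA addrAC subrK. Qed.

Lemma cdeg_shift al w S : cdeg (al + w) S = cdeg al S + w.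
Proof. by rewrite /cdeg addrAC. Qed.

Local Notation bd := (@koszul q K (fun=> 1) K^o).

(** [B] is a set of multidegrees, thought of as a basis of a module on which
    the variable [j] acts by translation by [v j], or by zero when the
    translate is outside [B]. The [k]-chains of multidegree [al] are the
    scalar functions supported on the sets [S] of size [k] with [cdeg al S] in
    [B]. Cycles and boundaries are only tested at such sets, since everything
    outside [B] is zero in the module. *)
Definition mchain B k al c :=
  forall S, c S != 0 -> #|S| = k /\ B (cdeg al S).

Definition mcycle B al c := forall S, B (cdeg al S) -> bd c S = 0.

Definition mboundary B k al c :=
  exists2 b, mchain B k.+1 al b & forall S, B (cdeg al S) -> c S = bd b S.

Definition acyclic B k al := forall c, mchain B k al c -> mcycle B al c -> mboundary B k al c.

Definition restrict B al c S : K^o := if B (cdeg al S) then c S else 0.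

(** Translation within [B] is an action of commuting variables only if no path
    leaves [B] and comes back. *)
Definition convex B := forall ga i j, B ga -> B (ga + v i + v j) -> B (ga + v i).

Lemma bd_neq0 c S : bd c S != 0 -> exists2 i, i \notin S & c (i |: S) != 0.
Proof.
move=> nz; have [/existsP[i /andP[]]|/existsPn n] := boolP [exists i, (i \notin S) && (c (i |: S) != 0)].
  by exists i.
case/eqP: nz; rewrite /koszul big1 // => i iS.
by have := n i; rewrite iS /= negbK => /eqP ->; rewrite scaler0.
Qed.

Lemma eq_bd c c' S : (forall i, i \notin S -> c (i |: S) = c' (i |: S)) -> bd c S = bd c' S.
Proof. by move=> e; apply: eq_bigr => i iS; rewrite e. Qed.

Lemma bd_eq0 c S : (forall i, i \notin S -> c (i |: S) = 0) -> bd c S = 0.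
Proof. by move=> e; rewrite /koszul big1 // => i iS; rewrite e ?scaler0. Qed.

Lemma bdB c c' S : bd (fun S => c S - c' S) S = bd c S - bd c' S.
Proof. exact: koszulB. Qed.

Lemma bdD c c' S : bd (fun S => c S + c' S) S = bd c S + bd c' S.
Proof.
rewrite -[bd c' S]opprK -[- bd c' S]add0r.
rewrite (_ : 0 - _ = bd (fun S => - c' S) S); last first.
  by rewrite sub0r -sumrN; apply: eq_bigr => i _; rewrite scalerN.
by rewrite -koszulB; apply: koszul_ext => U; rewrite opprK.
Qed.

Lemma mchain_bd B B' k al b : mchain B k.+1 al b -> mchain B' k al (restrict B' al (bd b)).
Proof.
move=> hb S; rewrite /restrict; case: ifP => [BS nz|]; last by rewrite eqxx.
split=> //; have [i iS /hb[]] := bd_neq0 nz.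
by rewrite cardsU1 iS => -[].
Qed.

(** The differential of the module spanned by [B] is the full one cut down to
    [B]; it squares to zero because, by convexity, no term of the full square
    goes through a point outside [B]. *)
Lemma bd_restrict_bd B k al b S : convex B -> mchain B k al b ->
  B (cdeg al S) -> bd (restrict B al (bd b)) S = 0.
Proof.
move=> cB hb BS; rewrite -[RHS](koszul_koszul (fun=> 1) b S); apply: eq_bd => i iS.
rewrite /restrict; case: ifPn => // nB; apply/esym/bd_eq0 => j jiS.
apply/eqP; apply: contraNT nB => /hb[_ Bji].
by rewrite (cdeg_add _ jiS) (cB _ _ i) // -!cdeg_add.
Qed.

Lemma mchain_sub B B' k al c : (forall ga, B ga -> B' ga) -> mchain B k al c -> mchain B' k al c.
Proof. by move=> s hc S /hc[-> /s]. Qed.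

Lemma mchainB B k al c c' : mchain B k al c -> mchain B k al c' ->
  mchain B k al (fun S => c S - c' S).
Proof.
move=> hc hc' S; have [c0|/hc //] := eqVneq (c S) 0.
by rewrite c0 sub0r oppr_eq0 => /hc'.
Qed.

Lemma mchainD B k al c c' : mchain B k al c -> mchain B k al c' ->
  mchain B k al (fun S => c S + c' S).
Proof.
move=> hc hc' S; have [c0|/hc //] := eqVneq (c S) 0.
by rewrite c0 add0r => /hc'.
Qed.

Lemma mchain_notin B k al c S : mchain B k al c -> ~~ B (cdeg al S) -> c S = 0.
Proof. by move=> hc nB; apply/eqP; apply: contraNT nB => /hc[]. Qed.

Lemma acyclic_ext B B' k al : B =1 B' -> acyclic B k al -> acyclic B' k al.
Proof.
move=> e hB c hc cy.
have [S|S|b hb cb] := hB c; first by move=> /hc[]; rewrite e.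
  by rewrite e => /cy.
by exists b => [S|S]; [move=> /hb[]; rewrite e|rewrite -e => /cb].
Qed.

Lemma acyclic_shift B B0 w k al : (forall ga, B ga = B0 (ga - w)) ->
  acyclic B0 k (al - w) -> acyclic B k al.
Proof.
move=> e hB c hc cy.
have eS S : B (cdeg al S) = B0 (cdeg (al - w) S) by rewrite e cdeg_shift.
have [S|S|b hb cb] := hB c; first by move=> /hc[]; rewrite eS.
  by rewrite -eS => /cy.
by exists b => [S|S]; [move=> /hb[]; rewrite eS|rewrite eS => /cb].
Qed.

(** [B1] spans a submodule of the module spanned by [B], with quotient spanned
    by [B2]. *)
Definition split_mod B B1 B2 :=
  [/\ forall ga, B ga = B1 ga || B2 ga, forall ga, B1 ga -> ~~ B2 ga
    & forall ga i, B1 ga -> B (ga + v i) -> B1 (ga + v i)].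

Section Split.
Variables (B B1 B2 : pred Gam) (al : Gam).
Hypotheses (cB : convex B) (spl : split_mod B B1 B2).

Let sub1 ga : B1 ga -> B ga.
Proof. by case: spl => e _ _; rewrite e => ->. Qed.

Let sub2 ga : B2 ga -> B ga.
Proof. by case: spl => e _ _; rewrite e => ->; rewrite orbT. Qed.

Lemma bd_restrict_quot k c S : mchain B k al c -> B2 (cdeg al S) ->
  bd (restrict B2 al c) S = bd c S.
Proof.
case: spl => e d u hc BS; apply: eq_bd => i iS; rewrite /restrict; case: ifPn => // n2.
apply/esym/eqP; apply: contraNT n2 => /hc[_]; rewrite e => /orP[h1|//].
have := u _ i h1; rewrite -cdeg_add // => h; have := d _ (h (sub2 BS)).
by rewrite BS.
Qed.

Lemma bd_sub_quot k c S : mchain B1 k al c -> B2 (cdeg al S) -> bd c S = 0.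
Proof.
case: spl => e d u hc BS; apply: bd_eq0 => i iS; apply/eqP; apply: contraT.
move=> /hc[_ h1]; have := u _ i h1; rewrite -cdeg_add // => h.
by have := d _ (h (sub2 BS)); rewrite BS.
Qed.

Lemma mchain_restrict B' k c : mchain B k al c -> mchain B' k al (restrict B' al c).
Proof. by move=> hc S; rewrite /restrict; case: ifP => [? /hc[]|]; rewrite ?eqxx. Qed.

(** The part of the long exact sequence around the middle term: lifting the
    bounding chain from the quotient moves a cycle into [B1]. The hypothesis
    on [B1] asks for boundaries in [B] only, which is what is available when
    the inclusion of [B1] kills homology. *)
Lemma acyclic_mid0 k : acyclic B2 k al ->
  (forall c, mchain B1 k al c -> mcycle B1 al c -> mboundary B k al c) ->
  acyclic B k al.
Proof.
move=> h2 h1 c hc cy; have [e d u] := spl.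
have [|S BS|b2 hb2 cb2] := h2 (restrict B2 al c); first exact: mchain_restrict.
  by rewrite (bd_restrict_quot hc BS) cy //; apply: sub2.
have hb2' := mchain_sub sub2 hb2.
have [|S BS|b1 hb1 cb1] := h1 (fun S => c S - restrict B al (bd b2) S).
- move=> S nz; have [-> BS] := mchainB hc (mchain_bd hb2') nz; split=> //.
  move: BS; rewrite e => /orP[//|BS]; case/eqP: nz.
  by have := cb2 S BS; rewrite /restrict BS (sub2 BS) => <-; rewrite subrr.
- by rewrite bdB cy ?(bd_restrict_bd cB hb2') ?subrr //; apply: sub1.
exists (fun S => b1 S + b2 S); first exact: mchainD.
by move=> S BS; rewrite bdD -cb1 // /restrict BS subrK.
Qed.

Lemma acyclic_mid k : acyclic B1 k al -> acyclic B2 k al -> acyclic B k al.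
Proof.
move=> h1 h2; apply: acyclic_mid0 h2 _ => c hc /(h1 _ hc)[b hb cb].
exists b; first exact: mchain_sub hb.
case: spl => e d u S; rewrite e => /orP[/cb //|BS].
by rewrite (bd_sub_quot hb BS) (mchain_notin hc) //; apply: contraTN BS => /d.
Qed.

(** Exactness at the quotient: the connecting map lands in the homology of
    [B1]. *)
Lemma acyclic_quot k : acyclic B k.+1 al -> acyclic B1 k al -> acyclic B2 k.+1 al.
Proof.
move=> h h1 c hc cy; have [e d u] := spl; have hc' := mchain_sub sub2 hc.
have [|S BS|b1 hb1 cb1] := h1 (restrict B1 al (bd c)); first exact: mchain_bd hc.
  rewrite -[RHS](bd_restrict_bd cB hc' (sub1 BS)); apply: eq_bd => i iS.
  rewrite /restrict e; case: ifP => //= n1; case: ifP => // n2.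
  by rewrite cy.
have [||b hb cb] := h (fun S => c S - b1 S).
- by apply: mchainB => //; apply: mchain_sub hb1.
- move=> S; rewrite bdB e => /orP[BS|BS]; first by rewrite -cb1 // /restrict BS subrr.
  by rewrite cy // (bd_sub_quot hb1) // subrr.
exists (restrict B2 al b); first exact: mchain_restrict.
move=> S BS; rewrite (bd_restrict_quot hb) // -cb; last exact: sub2.
by rewrite (mchain_notin hb1) ?subr0 //; apply: contraTN BS => /d.
Qed.

(** Exactness at the submodule: a class of [B1] that dies in [B] comes from
    the next homology group of [B2]. *)
Lemma acyclic_sub0 k c : acyclic B2 k.+1 al -> mchain B1 k al c ->
  mboundary B k al c -> mboundary B1 k al c.
Proof.
move=> h2 hc [b hb cb]; have [e d u] := spl.
have [||f hf bf] := h2 (restrict B2 al b); first exact: mchain_restrict.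
  move=> S BS; rewrite (bd_restrict_quot hb) // -cb; last exact: sub2.
  by rewrite (mchain_notin hc) //; apply: contraTN BS => /d.
have hf' := mchain_sub sub2 hf.
exists (fun S => b S - restrict B al (bd f) S) => [S nz|S BS]; last first.
  by rewrite bdB (bd_restrict_bd cB hf') -?cb ?subr0 //; apply: sub1.
have [-> BS] := mchainB hb (mchain_bd hf') nz; split=> //.
move: BS; rewrite e => /orP[//|BS]; case/eqP: nz.
by have := bf S BS; rewrite /restrict BS (sub2 BS) => <-; rewrite subrr.
Qed.

Lemma acyclic_sub k : acyclic B2 k.+1 al -> acyclic B k al -> acyclic B1 k al.
Proof.
move=> h2 h c hc cy; apply: acyclic_sub0 => //; apply: h; first exact: mchain_sub hc.
have [e d u] := spl => S; rewrite e => /orP[/cy //|BS].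
exact: bd_sub_quot hc BS.
Qed.

End Split.

Section Translate.
Variables (B : pred Gam) (z : 'I_q).
Hypotheses (cB : convex B) (up : forall ga, B ga -> B (ga + v z)).

(** Cokernel and image of multiplication by the variable [z] on the module
    spanned by [B]; the multiplication is injective as soon as [B] is stable
    under it. *)
Definition cok_mul : pred Gam := fun ga => B ga && ~~ B (ga - v z).

Definition img_mul : pred Gam := fun ga => B ga && B (ga - v z).

Lemma split_cok_mul : split_mod B img_mul cok_mul.
Proof.
rewrite /img_mul /cok_mul; split=> [ga|ga|ga i].
- by rewrite -andb_orr orbN andbT.
- by move=> /andP[-> ->].
- move=> /andP[h1 h2] h3; rewrite h3 /= addrAC (@cB _ _ z h2) //.
  by rewrite addrAC subrK.
Qed.

(** Multiplication by [z] is zero on homology, so a cycle supported on its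
    image bounds in [B]: the bounding chain is obtained by exterior
    multiplication. *)
Lemma img_mul_mboundary k al c : mchain img_mul k al c -> mcycle img_mul al c -> mboundary B k al c.
Proof.
move=> hc cy; exists (wedge z c).
  move=> S; rewrite /wedge; case: ifP => [zS|]; last by rewrite eqxx.
  rewrite scaler_eq0 negb_or => /andP[_] /hc[<-]; rewrite /img_mul => /andP[_].
  rewrite (@cdeg_add al z (S :\ z)) ?inE ?eqxx // setD1K // addrK => BS.
  by rewrite (cardsD1 z S) zS.
move=> S BS; have := koszul_wedge (fun=> 1) z c S.
rewrite scale1r => <-; rewrite [X in _ + X](_ : _ = 0) ?addr0 //.
rewrite /wedge; case: ifP => // zS; rewrite cy ?scaler0 //.
have e : cdeg al (S :\ z) = cdeg al S + v z.
  by rewrite (@cdeg_add al z (S :\ z)) ?inE ?eqxx // setD1K.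
by rewrite /img_mul e addrK BS up.
Qed.

(** The long exact sequence of the multiplication by [z] splits into short
    ones, so that homology of [B] embeds in that of the cokernel, in the same
    homological degree and multidegree. *)
Lemma acyclic_of_cok_mul k al : acyclic cok_mul k al -> acyclic B k al.
Proof.
by move=> h; apply: (acyclic_mid0 cB split_cok_mul h) => c; apply: img_mul_mboundary.
Qed.

(** The other half of the short exact sequences: homology of [B] is also a
    quotient of the next homology group of the cokernel, one step up in
    multidegree. It trades one unit of homological degree for one unit of
    depth. *)
Lemma acyclic_of_cok_mul_next k al : acyclic cok_mul k.+1 (al + v z) -> acyclic B k al.
Proof.
move=> h c hc cy.
have hc' : mchain img_mul k (al + v z) c.
  by move=> S /hc[-> BS]; rewrite /img_mul cdeg_shift up // addrK BS.
have cy' : mcycle img_mul (al + v z) c.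
  by move=> S; rewrite /img_mul cdeg_shift addrK => /andP[_ /cy].
have [b hb cb] := acyclic_sub0 cB split_cok_mul h hc' (img_mul_mboundary hc' cy').
exists b => [S /hb[->]|S BS]; first by rewrite /img_mul cdeg_shift addrK => /andP[].
by apply: cb; rewrite /img_mul cdeg_shift addrK BS up.
Qed.

Lemma cok_mul_acyclic k al : acyclic B k al -> acyclic B k.+1 (al + v z) ->
  acyclic cok_mul k.+1 (al + v z).
Proof.
move=> h h'; apply: (acyclic_quot cB split_cok_mul) => //.
apply: (@acyclic_shift _ B (v z)); last by rewrite addrK.
move=> ga; rewrite /img_mul; case: (boolP (B (ga - v z))) => [/up|]; last by rewrite andbF.
by rewrite subrK => ->.
Qed.

End Translate.
End Multigraded.

(** * The cone over the covers and its faces *)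

(** The point of the monomial [x^a t^b] is [(a, b)]. Integer rather than
    natural coordinates make all translations available. *)
Definition point n : zmodType := ({ffun 'I_n -> int} * int)%type.

Definition coord n (ga : point n) (x : 'I_n) : int := ga.1 x.

Definition tdeg n (ga : point n) : int := ga.2.

Section Points.
Variables (n q : nat) (v : 'I_q -> point n).
Implicit Types (ga al : point n).

Lemma coordD ga ga' x : coord (ga + ga') x = coord ga x + coord ga' x.
Proof. by rewrite /coord ffunE. Qed.

Lemma coordN ga x : coord (- ga) x = - coord ga x.
Proof. by rewrite /coord ffunE. Qed.

Lemma tdegD ga ga' : tdeg (ga + ga') = tdeg ga + tdeg ga'.
Proof. by []. Qed.

Lemma tdegN ga : tdeg (- ga) = - tdeg ga.
Proof. by []. Qed.

Lemma tdeg_cdeg al S : (forall j, tdeg (v j) = 1) -> tdeg (cdeg v al S) = tdeg al - #|S|%:Z.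
Proof.
move=> v1; rewrite /cdeg tdegD tdegN; congr (_ - _).
rewrite (@big_morph _ _ (fun g : point n => tdeg g) 0 +%R 0 +%R) //=.
by rewrite (eq_bigr (fun=> 1)) ?sumr_const ?natz // => j _; rewrite v1.
Qed.

End Points.

Section Cone.
Variables (K : fieldType) (n q : nat).
Variables (X : {set 'I_n}) (mu : 'I_n -> 'I_n) (r : rel 'I_n) (C : 'I_q -> {set 'I_n}).
Implicit Types (D E T U : {set 'I_n}) (ga al be : point n) (x y w : 'I_n).

Hypothesis muX : forall x, (mu x \in X) = (x \notin X).
Hypothesis muK : involutive mu.

(** The order ideals of the relation [r] on [X]; they will be the traces of
    the covers. *)
Definition downset D := [forall x in X, forall w in X, r x w && (w \in D) ==> (x \in D)].

Definition good_cover E :=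
  downset (E :&: X) && [forall x, (mu x \in E) == (x \notin E)].

Hypothesis C_good : forall j, good_cover (C j).
Hypothesis C_all : forall E, good_cover E -> exists j, C j = E.

Definition cover_point j : point n := ([ffun x => (x \in C j)%:Z], 1).

(** The inequality for [r x w] is the covering condition of the edge from [x]
    to [mu w], after elimination of the coordinate of [mu w]. *)
Definition cone ga : bool :=
  [&& 0 <= tdeg ga, [forall x, (0 <= coord ga x) && (coord ga x + coord ga (mu x) == tdeg ga)]
    & [forall x in X, forall w in X, r x w ==> (coord ga w <= coord ga x)]].

(** The open conditions [U] are there because the submodules in the exact
    sequences below are spanned by faces deprived of some of their own faces. *)
Definition face D U : pred (point n) := fun ga =>
  [&& cone ga, [forall x in D, coord ga x == tdeg ga] & [forall x in U, coord ga x < tdeg ga]].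

Definition faces D U T : pred (point n) := fun ga =>
  face D U ga && [exists x in T, coord ga x == tdeg ga].

Lemma downsetP D : reflect (forall x w, x \in X -> w \in X -> r x w -> w \in D -> x \in D) (downset D).
Proof.
apply: (iffP forall_inP) => [h x w xX wX rxw wD|h x xX].
  by have /forall_inP/(_ _ wX) := h _ xX; rewrite rxw wD.
by apply/forall_inP => w wX; apply/implyP => /andP[]; apply: h.
Qed.

Lemma C_mu j x : (mu x \in C j) = (x \notin C j).
Proof. by have /andP[_ /forallP/(_ x)/eqP] := C_good j. Qed.

Lemma C_down j x w : x \in X -> w \in X -> r x w -> w \in C j -> x \in C j.
Proof.
move=> xX wX rxw wC; have /andP[/downsetP h _] := C_good j.
by have := h x w xX wX rxw; rewrite !inE xX wX wC; case: (x \in C j) => // /(_ isT).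
Qed.

Lemma coord_cover_point j x : coord (cover_point j) x = (x \in C j)%:Z.
Proof. by rewrite /coord ffunE. Qed.

Lemma tdeg_cover_point j : tdeg (cover_point j) = 1.
Proof. by []. Qed.

Definition pointE := (coordD, coordN, tdegD, tdegN, coord_cover_point, tdeg_cover_point).

Record cone_spec ga : Prop := ConeSpec {
  cone_ge0 : 0 <= tdeg ga;
  cone_pos : forall x, 0 <= coord ga x;
  cone_mu : forall x, coord ga x + coord ga (mu x) = tdeg ga;
  cone_mono : forall x w, x \in X -> w \in X -> r x w -> coord ga w <= coord ga x }.

Lemma coneP ga : reflect (cone_spec ga) (cone ga).
Proof.
apply: (iffP and3P) => [[g0 /forallP h /forall_inP m]|[g0 h1 h2 m]]; split=> //.
- by move=> x; case/andP: (h x).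
- by move=> x; case/andP: (h x) => _ /eqP.
- by move=> x w xX wX rxw; have /forall_inP/(_ w wX) := m x xX; rewrite rxw.
- by apply/forallP => x; rewrite h1 h2 eqxx.
- by apply/forall_inP => x xX; apply/forall_inP => w wX; apply/implyP; apply: m.
Qed.

Lemma cone_le ga x : cone_spec ga -> coord ga x <= tdeg ga.
Proof. by move=> c; have := cone_mu c x; have := cone_pos c (mu x); lia. Qed.

Record face_spec D U ga : Prop := FaceSpec {
  face_cone : cone_spec ga;
  face_eq : forall x, x \in D -> coord ga x = tdeg ga;
  face_lt : forall x, x \in U -> coord ga x < tdeg ga }.

Lemma faceP D U ga : reflect (face_spec D U ga) (face D U ga).
Proof.
apply: (iffP and3P) => [[/coneP c /forall_inP h /forall_inP u]|[c h u]]; split=> //.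
- by move=> x /h/eqP.
- exact/coneP.
- by apply/forall_inP => x /h ->.
- exact/forall_inP.
Qed.

Lemma facesP D U T ga :
  reflect (face_spec D U ga /\ exists2 x, x \in T & coord ga x = tdeg ga) (faces D U T ga).
Proof.
apply: (iffP andP) => [[/faceP f /exists_inP[x xT /eqP e]]|[f [x xT e]]].
  by split=> //; exists x.
by split; [exact/faceP|apply/exists_inP; exists x => //; apply/eqP].
Qed.

Lemma cone_add ga j : cone_spec ga -> cone_spec (ga + cover_point j).
Proof.
move=> c; split=> [|x|x|x w xX wX rxw]; rewrite !pointE /=.
- by have := cone_ge0 c; lia.
- by have := cone_pos c x; case: (x \in C _); lia.
- by rewrite C_mu; have := cone_mu c x; case: (x \in C _) => /=; lia.
- have := cone_mono c xX wX rxw; have := C_down (j := j) xX wX rxw.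
  case: (w \in C j) => [/(_ isT) ->|_] /=; first by lia.
  by case: (x \in C j) => /=; lia.
Qed.

Lemma face_convex D U : convex cover_point (face D U).
Proof.
move=> ga i j /faceP[c e l] /faceP[c' e' l']; apply/faceP; split.
- exact: cone_add.
- move=> x xD; have := e x xD; have := e' x xD; rewrite !pointE /=.
  by case: (x \in C i); case: (x \in C j) => /=; lia.
- by move=> x /l; rewrite !pointE /=; case: (x \in C i) => /=; lia.
Qed.

(** Translation by a cover never decreases the nonnegative number [b - a x],
    so a point with [a x = b] can only be reached through such points. *)
Lemma faces_convex D U T : convex cover_point (faces D U T).
Proof.
move=> ga i j /facesP[f _] /facesP[f' [x xT e']].
apply/facesP; split; first by apply/faceP/(face_convex (j := j)); apply/faceP.
exists x => //; have := cone_le x (face_cone f); move: e'.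
by rewrite !pointE /=; case: (x \in C i); case: (x \in C j) => /=; lia.
Qed.

(** Adding the face [a x = b] to a union of faces: the quotient is that face,
    and the submodule is what the union has outside of it. *)
Lemma split_faces_add D T x : x \notin T ->
  split_mod cover_point (faces D set0 (x |: T)) (faces D [set x] T) (face (x |: D) set0).
Proof.
move=> xT; split=> [ga|ga|ga i].
- apply/facesP/orP => [[f [y yT ey]]|[/facesP[f [y yT ey]]|/faceP[c e l]]].
  + have [xe|xe] := eqVneq (coord ga x) (tdeg ga); [right|left].
      apply/faceP; split=> // [|u|u]; last by rewrite inE.
        exact: (face_cone f).
      by rewrite !inE => /predU1P[->//|]; apply: (face_eq f).
    apply/facesP; split.
      split; [exact: (face_cone f)|exact: (face_eq f)|].
      by move=> u /set1P ->; rewrite lt_neqAle xe (cone_le _ (face_cone f)).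
    exists y => //; move: yT; rewrite !inE => /predU1P[yx|//].
    by rewrite -yx ey eqxx in xe.
  + split; last by exists y => //; rewrite inE yT orbT.
    by split; [exact: (face_cone f)|exact: (face_eq f)|move=> u; rewrite inE].
  + split; last by exists x; [rewrite setU11|apply: e; rewrite setU11].
    by split=> // u uD; apply: e; rewrite inE uD orbT.
- move=> /facesP[f _]; apply/faceP => -[c e l].
  by have := face_lt f (set11 x); rewrite (e x) ?setU11 // ltxx.
- move=> /facesP[f [y yT ey]] /facesP[f' [y' yT' ey']].
  have l : coord (ga + cover_point i) x < tdeg (ga + cover_point i).
    by have := face_lt f (set11 x); rewrite !pointE /=; case: (x \in C _) => /=; lia.
  apply/facesP; split.
    by split; [exact: (face_cone f')|exact: (face_eq f')|move=> u /set1P ->].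
  exists y' => //; move: yT'; rewrite !inE => /predU1P[y'x|//].
  by rewrite y'x in ey'; rewrite ey' ltxx in l.
Qed.

(** The part of a union of faces outside [a x = b] is also the kernel of
    restriction to the trace of the union on that face. Together with
    [split_faces_add] this is the Mayer-Vietoris sequence of the union and the
    new face. *)
Lemma split_faces_lt D T x :
  split_mod cover_point (faces D set0 T) (faces D [set x] T) (faces (x |: D) set0 T).
Proof.
split=> [ga|ga|ga i].
- apply/facesP/orP => [[f e]|[/facesP[f e]|/facesP[f e]]].
  + have [xe|xe] := eqVneq (coord ga x) (tdeg ga); [right|left].
      apply/facesP; split=> //; split=> // [|u|u]; last by rewrite inE.
        exact: (face_cone f).
      by rewrite !inE => /predU1P[->//|]; apply: (face_eq f).
    apply/facesP; split=> //; split; [exact: (face_cone f)|exact: (face_eq f)|].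
    by move=> u /set1P ->; rewrite lt_neqAle xe (cone_le _ (face_cone f)).
  + split=> //.
    by split; [exact: (face_cone f)|exact: (face_eq f)|move=> u; rewrite inE].
  + split=> //; split; [exact: (face_cone f)| |exact: (face_lt f)].
    by move=> u uD; apply: (face_eq f); rewrite inE uD orbT.
- move=> /facesP[f _]; apply/facesP => -[[c e l] _].
  by have := face_lt f (set11 x); rewrite (e x) ?setU11 // ltxx.
- move=> /facesP[f _] /facesP[f' e'].
  have l : coord (ga + cover_point i) x < tdeg (ga + cover_point i).
    by have := face_lt f (set11 x); rewrite !pointE /=; case: (x \in C _) => /=; lia.
  apply/facesP; split=> //.
  by split; [exact: (face_cone f')|exact: (face_eq f')|move=> u /set1P ->].
Qed.

(** A union of faces modulo all of them but one is the last face without its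
    intersections with the others. *)
Lemma split_faces_top D T x : x \notin T ->
  split_mod cover_point (faces D set0 (x |: T)) (face (x |: D) T) (faces D set0 T).
Proof.
move=> xT; split=> [ga|ga|ga i].
- apply/facesP/orP => [[f [y yT ey]]|[/faceP[c e l]|/facesP[f [y yT ey]]]].
  + have [h|h] := boolP [exists y in T, coord ga y == tdeg ga]; [right|left].
      by apply/facesP; split=> //; case/exists_inP: h => w ? /eqP ?; exists w.
    have h' u : u \in T -> coord ga u < tdeg ga.
      move=> uT; rewrite lt_neqAle (cone_le _ (face_cone f)) andbT.
      by apply: contraNneq h => eu; apply/exists_inP; exists u => //; apply/eqP.
    apply/faceP; split=> //; first exact: (face_cone f).
    move=> u; rewrite !inE => /predU1P[->|]; last exact: (face_eq f).
    by move: yT; rewrite !inE => /predU1P[<-//|/h']; rewrite ey ltxx.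
  + split; last by exists x; [rewrite setU11|apply: e; rewrite setU11].
    by split=> // [u uD|u]; [apply: e; rewrite inE uD orbT|rewrite inE].
  + by split=> //; exists y => //; rewrite inE yT orbT.
- move=> /faceP[c e l]; apply/facesP => -[f [y yT ey]].
  by have := l y yT; rewrite ey ltxx.
- move=> /faceP[c e l] /facesP[f' [y yT ey]].
  have l' u : u \in T -> coord (ga + cover_point i) u < tdeg (ga + cover_point i).
    by move=> /l; rewrite !pointE /=; case: (u \in C _) => /=; lia.
  apply/faceP; split=> //; first exact: (face_cone f').
  move=> u; rewrite !inE => /predU1P[->|]; last exact: (face_eq f').
  by move: yT; rewrite !inE => /predU1P[<-//|/l']; rewrite ey ltxx.
Qed.

(** Closed subsets of [X] are the traces of covers: the part outside [X]
    consists of the partners of the complement. *)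
Lemma exists_cover D : downset D -> D \subset X ->
  exists z, forall x, (x \in C z) = if x \in X then x \in D else mu x \notin D.
Proof.
move=> /downsetP dD DX.
have [|z Cz] := C_all (E := [set x | if x \in X then x \in D else mu x \notin D]).
  apply/andP; split.
    apply/downsetP => x w xX wX rxw; rewrite !inE xX wX andbT => wD.
    by rewrite (dD x w).
  apply/forallP => x; rewrite !inE muX muK; have [xX|xX] /= := boolP (x \in X) => //.
  by rewrite negbK.
by exists z => x; rewrite Cz inE.
Qed.

(** When the cover of trace [D] can be subtracted: [a] must be positive on
    [D], less than the level on the rest of [X], and larger on [D] than off
    [D], so that lowering it on [D] preserves monotonicity. *)
Lemma cone_sub D z ga : downset D ->
  (forall x, (x \in C z) = if x \in X then x \in D else mu x \notin D) ->
  cone_spec ga -> 0 < tdeg ga -> (forall x, x \in X -> x \in D -> 0 < coord ga x) ->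
  (forall x, x \in X -> x \notin D -> coord ga x < tdeg ga) ->
  (forall x w, x \in D -> w \in X -> w \notin D -> coord ga w < coord ga x) ->
  cone_spec (ga - cover_point z).
Proof.
move=> /downsetP dD Cz c g0 pos lt sep.
have posX x : x \in X -> 0 <= coord (ga - cover_point z) x /\ 0 <= coord (ga - cover_point z) (mu x).
  move=> xX; rewrite !pointE !Cz muX xX muK /=.
  have := cone_pos c x; have := cone_pos c (mu x); have := cone_mu c x.
  case: (boolP (x \in D)) => [/(pos x xX)|/(lt x xX)] /=; lia.
split=> [|x|x|x w xX wX rxw].
- by rewrite !pointE; lia.
- have [/posX[]//|xX] := boolP (x \in X).
  have /posX[_] : mu x \in X by rewrite muX.
  by rewrite muK.
- rewrite !pointE !Cz muX muK; have := cone_mu c x.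
  by case: (x \in X) => /=; case: (_ \in D) => /=; lia.
- have := cone_mono c xX wX rxw; rewrite !pointE !Cz xX wX.
  have [wD|wD] := boolP (w \in D); first by rewrite (dD x w) //=; lia.
  by have [/(sep x w)/(_ wX wD)|] := boolP (x \in D) => /=; lia.
Qed.

Lemma face_sub D z ga : downset D -> D \subset X ->
  (forall x, (x \in C z) = if x \in X then x \in D else mu x \notin D) ->
  0 < tdeg ga -> face D (X :\: D) ga -> face D set0 (ga - cover_point z).
Proof.
move=> dD DX Cz g0 /faceP[c e l]; apply/faceP; split=> [|x xD|x]; last by rewrite inE.
  have l' x : x \in X -> x \notin D -> coord ga x < tdeg ga.
    by move=> xX xD; apply: l; rewrite inE xD.
  apply: (cone_sub dD Cz c g0) => // [x _ /e ->//|x w /e -> wX wD].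
  exact: l'.
by rewrite !pointE Cz (subsetP DX) // xD e.
Qed.

Lemma cone_face ga : face set0 set0 ga = cone ga.
Proof.
by apply/faceP/coneP => [[]//|c]; split=> // x; rewrite inE.
Qed.

(** The support of [a] in [X] is closed because [a] is monotone, and on it [a]
    is at least one while it vanishes on the rest of [X]. *)
Lemma cone_decompose ga : cone ga -> 0 < tdeg ga -> exists z, cone (ga - cover_point z).
Proof.
move=> /coneP c g0; pose D := [set x in X | 0 < coord ga x].
have dD : downset D.
  apply/downsetP => x w xX wX rxw; rewrite !inE xX => /andP[_].
  by have := cone_mono c xX wX rxw; lia.
have [|z Cz] := exists_cover dD; first by apply/subsetP => x; rewrite inE => /andP[].
exists z; apply/coneP/(cone_sub dD Cz c g0) => [x xX|x xX|x w].
- by rewrite inE => /andP[].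
- by rewrite inE xX /= -leNgt => h; apply: le_lt_trans h g0.
- by rewrite !inE => /andP[xX x0] -> /=; rewrite -leNgt => h; apply: le_lt_trans h x0.
Qed.

Lemma faces_eq D D' U T : face D U =1 face D' U -> faces D U T =1 faces D' U T.
Proof. by move=> e ga; rewrite /faces e. Qed.

(** By monotonicity, a point with [a x = b] has [a y = b] whenever [r y x]; so
    the condition [a = b on x |: D] may be imposed on the smallest closed set
    [D'] containing [x |: D], and faces may always be indexed by closed sets.
    Given a point of the face, the set where [a = b] is one of the closed sets
    in the intersection defining [D']. *)
Lemma downset_closure D x : D \subset X -> x \in X ->
  exists D', [/\ downset D', D' \subset X, x |: D \subset D'
    & forall U, face (x |: D) U =1 face D' U].
Proof.
move=> DX xX; have xDX : x |: D \subset X by rewrite subUset sub1set xX.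
pose P E := [&& downset E, E \subset X & x |: D \subset E].
have PX : P X by apply/and3P; split=> //; apply/downsetP.
pose D' := \bigcap_(E | P E) E; exists D'.
have sD : x |: D \subset D' by apply/bigcapsP => E /and3P[].
split=> // [||U ga].
- apply/downsetP => u w uX wX ruw /bigcapP wD; apply/bigcapP => E PE.
  by have /and3P[/downsetP dE _ _] := PE; apply: dE ruw (wD _ PE).
- exact: (bigcap_inf X).
apply/faceP/faceP => -[c e l]; split=> // u uD; last by apply: e; apply: (subsetP sD).
have : u \in [set u in X | coord ga u == tdeg ga].
  apply: (bigcapP uD); apply/and3P; split.
  - apply/downsetP => y w yX wX ryw; rewrite !inE yX => /andP[_ /eqP ew].
    by have := cone_mono c yX wX ryw; have := cone_le y c; rewrite ew; lia.
  - by apply/subsetP => y; rewrite inE => /andP[].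
  - by apply/subsetP => y yD; rewrite inE (subsetP xDX) // e ?eqxx.
by rewrite inE => /andP[_ /eqP].
Qed.

Local Notation acyclic := (@acyclic K q _ cover_point).

Lemma acyclic_empty (B : pred (point n)) k al :
  (forall S : {set 'I_q}, #|S| = k -> ~~ B (cdeg cover_point al S)) -> acyclic B k al.
Proof.
move=> h c hc cy; exists (fun=> 0) => [S|S _]; first by rewrite eqxx.
rewrite bd_eq0 //; apply/eqP; apply: contraT => /hc[/h]; by move=> /negbTE ->.
Qed.

Section Cokernel.
Variables (D : {set 'I_n}) (z : 'I_q).
Hypotheses (dD : downset D) (DX : D \subset X).
Hypothesis Cz : forall x, (x \in C z) = if x \in X then x \in D else mu x \notin D.

Lemma face_add ga : face D set0 ga -> face D set0 (ga + cover_point z).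
Proof.
move=> /faceP[c e _]; apply/faceP; split=> [|x xD|x]; last by rewrite inE.
  exact: cone_add.
by rewrite !pointE Cz (subsetP DX) // xD e.
Qed.

(** When [D] is all of [X] the face is a ray and the cokernel is reduced to
    its origin. *)
Lemma cok_mul_face0 ga : cok_mul cover_point (face D set0) z ga -> X :\: D = set0 -> tdeg ga = 0.
Proof.
move=> /andP[/faceP[c e _]] nf XD; apply/eqP; apply: contraT => g0.
case/negP: nf; apply: face_sub => //; first by rewrite lt_neqAle eq_sym g0 (cone_ge0 c).
by rewrite XD; apply/faceP; split=> // x; rewrite inE.
Qed.

(** A point of the face remains in it after subtraction of the cover of trace
    [D] exactly when [a < b] on the rest of [X]. *)
Lemma cok_mul_face : X :\: D != set0 ->
  cok_mul cover_point (face D set0) z =1 faces D set0 (X :\: D).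
Proof.
move=> /set0Pn[x0 x0D] ga; apply/andP/facesP => [[/faceP f nf]|[f [x]]].
  split=> //; have [/exists_inP[x xD /eqP e]|h] := boolP [exists x in X :\: D, coord ga x == tdeg ga].
    by exists x.
  have h' u : u \in X :\: D -> coord ga u < tdeg ga.
    move=> uT; rewrite lt_neqAle (cone_le _ (face_cone f)) andbT.
    by apply: contraNneq h => eu; apply/exists_inP; exists u => //; apply/eqP.
  case/negP: nf; apply: face_sub => //.
    by apply: le_lt_trans (h' _ x0D); apply: cone_pos (face_cone f) _.
  by apply/faceP; split=> //; [apply: (face_cone f)|apply: (face_eq f)].
rewrite inE => /andP[xD xX] e; split; first exact/faceP.
apply/negP => /faceP[/(cone_le x)]; rewrite !pointE Cz xX (negbTE xD) e /=; lia.
Qed.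

End Cokernel.

(** Induction on the number of faces in the union, by the Mayer-Vietoris
    argument of [split_faces_add] and [split_faces_lt]. The predicate [Q]
    delimits the range of homological and total degrees in which vanishing is
    claimed, so that the same induction serves for regularity and for depth. *)
Lemma faces_acyclic (Q : nat -> int -> Prop) D :
  (forall x k al, x \in X :\: D -> Q k (tdeg al) ->
     acyclic (face (x |: D) set0) k al) ->
  (forall x T k al, x \in X :\: D -> T \subset X :\: (x |: D) -> T != set0 ->
     Q k (tdeg al) -> acyclic (faces (x |: D) set0 T) k.+1 al) ->
  forall T k al, T \subset X :\: D -> T != set0 -> Q k (tdeg al) ->
    acyclic (faces D set0 T) k al.
Proof.
move=> h1 h2 T; have [m] := ubnP #|T|; elim: m T => // m IH T Tm k al TD /set0Pn[x xT] Qk.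
have xD : x \in X :\: D by apply: (subsetP TD).
rewrite -(setD1K xT); have xT' : x \notin T :\ x by rewrite !inE eqxx.
apply: (acyclic_mid (@faces_convex _ _ _) (split_faces_add _ xT')); last exact: h1.
have [->|T0] := eqVneq (T :\ x) set0.
  by apply: acyclic_empty => S _; apply/facesP => -[_ [y]]; rewrite inE.
apply: (acyclic_sub (@faces_convex _ _ _) (split_faces_lt _ _ _)).
  apply: h2 => //; apply/subsetP => y; rewrite !inE => /andP[yx yT].
  by have := subsetP TD _ yT; rewrite !inE negb_or yx.
apply: IH => //; first by rewrite [#|T|](cardsD1 x) xT in Tm.
exact: subset_trans (subsetDl _ _) TD.
Qed.

(** Both statements are proved together by induction on [m]: unions of faces
    come from faces of smaller dimension, and the face from the union of all
    its proper faces through [acyclic_of_cok_mul]. A closed set containing [x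
    |: D] may absorb elements of [T]; then the trace of the union is a whole
    face, and the induction hypothesis for faces takes over. *)
Lemma face_regularity m D : #|X :\: D| = m -> downset D -> D \subset X ->
  (forall k al, (k + m.-1)%:Z < tdeg al -> acyclic (face D set0) k al) /\
  (forall T k al, T \subset X :\: D -> T != set0 -> (k + m.-1)%:Z < tdeg al ->
     acyclic (faces D set0 T) k al).
Proof.
elim/ltn_ind: m D => m IH D Dm dD DX.
have hT T k al : T \subset X :\: D -> T != set0 -> (k + m.-1)%:Z < tdeg al ->
     acyclic (faces D set0 T) k al.
  have cl x : x \in X :\: D -> exists D', [/\ downset D', D' \subset X,
      forall U, face (x |: D) U =1 face D' U & (#|X :\: D'| < m)%N].
    rewrite inE => /andP[xD xX]; have [D' [dD' DX' s e]] := downset_closure DX xX.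
    exists D'; split=> //; rewrite -Dm; apply: proper_card; apply/properP; split.
      by apply: setDS; apply: subset_trans s; apply: subsetUr.
    by exists x; rewrite inE ?xD // xX (subsetP s) ?setU11.
  apply: (@faces_acyclic (fun k d => (k + m.-1)%:Z < d)) => {T k al} [x k al xD kd|x T k al xD TX T0 kd].
    have [D' [dD' DX' e lt]] := cl x xD.
    apply: (acyclic_ext (fun ga => esym (e set0 ga))).
    by apply: (IH _ lt D' erefl dD' DX').1; lia.
  have [D' [dD' DX' e lt]] := cl x xD.
  apply: (acyclic_ext (fun ga => esym (faces_eq T (e set0) ga))).
  have [IH1 IH2] := IH _ lt D' erefl dD' DX'.
  (* [x] and an element of [T] are two elements of [X :\: D], so that the
     loss of one homological degree is affordable even if [D'] is all of [X] *)
  have m2 : (1 < m)%N.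
    rewrite -Dm (cardsD1 x) xD ltnS card_gt0; case/set0Pn: T0 => y yT.
    apply/set0Pn; exists y; have := subsetP TX _ yT.
    by rewrite !inE negb_or => /andP[/andP[-> ->] ->].
  have [TD|/subsetPn[y yT yD]] := boolP (T \subset X :\: D').
    apply: IH2 => //; have : (0 < #|X :\: D'|)%N.
      by rewrite card_gt0; apply: contraNneq T0 => D0; rewrite -subset0 -D0.
    by lia.
  apply: (@acyclic_ext _ _ _ _ (face D' set0)); last by apply: IH1; lia.
  have yD' : y \in D'.
    by move: yD (subsetP TX _ yT); rewrite !inE; case: (y \in D') => //= /negP + /andP[].
  move=> ga; apply/faceP/facesP => [f|[]//]; split=> //.
  by exists y => //; apply: (face_eq f).
split=> // k al kd; have [z Cz] := exists_cover dD DX.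
have up := face_add DX Cz.
apply: (acyclic_of_cok_mul (@face_convex _ _) up).
have [D0|D0] := eqVneq (X :\: D) set0.
  apply: acyclic_empty => S Sk; apply/negP => /cok_mul_face0 -/(_ dD DX Cz D0).
  by rewrite tdeg_cdeg // Sk; lia.
apply: acyclic_ext (fun ga => esym (cok_mul_face dD DX Cz D0 ga)) _.
exact: hT.
Qed.

(** When [r] is the identity every subset of [X] is closed and adding [x] to
    [D] lowers the dimension by exactly one, which is what a depth count
    needs. *)
Section Antichain.
Hypothesis C_inj : injective C.
Hypothesis r_eq : forall x w, x \in X -> w \in X -> r x w -> x = w.

Lemma downset_all D : downset D.
Proof. by apply/downsetP => x w xX wX /r_eq ->. Qed.

Lemma card_compl_add D x m : #|X :\: D| = m.+1 -> x \in X :\: D -> #|X :\: (x |: D)| = m.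
Proof.
move=> Dm xD; apply/eqP; rewrite -eqSS -Dm (cardsD1 x (X :\: D)) xD add1n eqSS; apply/eqP.
by congr #|pred_of_set _|; rewrite setDDl setUC.
Qed.

(** In terms of depth: the face of [D] has depth at least [m.+1] over the
    polynomial ring in [q] variables, and unions of its proper faces have
    depth at least [m]; the induction is that of [face_regularity], with
    [acyclic_of_cok_mul_next] in place of [acyclic_of_cok_mul]. *)
Lemma face_depth m D : #|X :\: D| = m -> D \subset X ->
  (forall k al, (q < k + m.+1)%N -> acyclic (face D set0) k al) /\
  (forall T k al, T \subset X :\: D -> T != set0 -> (q < k + m)%N ->
     acyclic (faces D set0 T) k al).
Proof.
elim: m D => [|m IH] D Dm DX.
  have D0 : X :\: D = set0 by apply/eqP; rewrite -cards_eq0 Dm.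
  split=> [k al kq|T k al]; last by rewrite D0 subset0 => ->.
  have [z Cz] := exists_cover (downset_all D) DX.
  apply: (acyclic_of_cok_mul_next (@face_convex _ _) (face_add DX Cz)).
  apply: acyclic_empty => S Sk; exfalso.
  by have := max_card (mem S); rewrite Sk card_ord; lia.
have hT T k al : T \subset X :\: D -> T != set0 -> (q < k + m.+1)%N ->
     acyclic (faces D set0 T) k al.
  have DX' x : x \in X :\: D -> x |: D \subset X.
    by rewrite inE subUset sub1set DX => /andP[_ ->].
  apply: (@faces_acyclic (fun k _ => (q < k + m.+1)%N)) => {T k al} [x k al xD kd|x T k al xD TX T0 kd].
    exact: (IH _ (card_compl_add Dm xD) (DX' x xD)).1.
  by apply: (IH _ (card_compl_add Dm xD) (DX' x xD)).2 => //; lia.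
split=> // k al kq; have [z Cz] := exists_cover (downset_all D) DX.
apply: (acyclic_of_cok_mul_next (@face_convex _ _) (face_add DX Cz)).
have D0 : X :\: D != set0 by rewrite -cards_eq0 Dm.
apply: acyclic_ext (fun ga => esym (cok_mul_face (downset_all D) DX Cz D0 ga)) _.
by apply: hT => //; lia.
Qed.

(** On the ray of [D = X] only the variable [z] acts nontrivially, so the
    exterior product of all the other variables is a cycle. It does not bound:
    the only set of size [q] is the full one, which would need a coefficient
    of degree [-1]. *)
Lemma face_not_acyclic0 D : D \subset X -> X :\: D = set0 ->
  ~ (forall al, tdeg al = q%:Z - 1 -> acyclic (face D set0) q.-1 al).
Proof.
move=> DX D0 h; have [z Cz] := exists_cover (downset_all D) DX.
have ptz : cdeg cover_point (\sum_(i in [set~ z]) cover_point i) [set~ z] = 0 by rewrite /cdeg subrr.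
have dz : tdeg (\sum_(i in [set~ z]) cover_point i) = q%:Z - 1.
  have := @tdeg_cdeg _ _ cover_point (\sum_(i in [set~ z]) cover_point i) [set~ z] tdeg_cover_point.
  rewrite ptz cardsC1 card_ord /tdeg => /esym/subr0_eq ->.
  by have := ltn_ord z; lia.
have F0 : face D set0 0.
  apply/faceP; split=> [|x _|x]; rewrite ?inE // ?/coord ?ffunE //.
  by split=> // *; rewrite /coord !ffunE.
have [||b hb cb] := h _ dz (fun S => if S == [set~ z] then 1 else 0).
- move=> S; case: (S =P [set~ z]) => [->|_]; last by rewrite eqxx.
  by rewrite ptz F0 cardsC1 card_ord.
- move=> S BS; apply/eqP; apply: contraT => /bd_neq0[i iS].
  case: (_ =P [set~ z]) => [e|_]; last by rewrite eqxx.
  have : cdeg cover_point (\sum_(i in [set~ z]) cover_point i) S = cover_point i.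
    by rewrite (cdeg_add _ _ iS) e ptz add0r.
  move: BS => /[swap] -> /faceP[c f _].
  have : C i = C z.
    apply/setP => x; have E y : y \in X -> y \in C i.
      move=> yX; have yD : y \in D.
        by apply: contraT => yD; rewrite -(in_set0 y) -D0 inE yD.
      by have := f y yD; rewrite coord_cover_point tdeg_cover_point; case: (y \in C i).
    have E' y : y \in X -> y \in C z.
      move=> yX; rewrite Cz yX; apply: contraT => yD.
      by rewrite -(in_set0 y) -D0 inE yD.
    have [xX|xX] := boolP (x \in X); first by rewrite E // E'.
    by apply: negb_inj; rewrite -!C_mu E ?E' ?muX.
  by move=> /C_inj iz; move: (setU11 i S); rewrite e !inE iz eqxx.
have zq : #|[set~ z]| = q.-1 by rewrite cardsC1 card_ord.
have := cb [set~ z]; rewrite ptz F0 eqxx => /(_ isT)/eqP; rewrite eq_sym => /eqP b1.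
have : koszul (fun=> 1) b [set~ z] != 0 by rewrite b1 oner_eq0.
case/bd_neq0 => i; rewrite !inE negbK => /eqP-> /hb[_].
have -> : cdeg cover_point (\sum_(i in [set~ z]) cover_point i) (z |: [set~ z]) = - cover_point z.
  apply/eqP; rewrite -addr_eq0 -cdeg_add ?ptz //.
  by rewrite !inE eqxx.
by case/faceP => /cone_ge0; rewrite !pointE.
Qed.

(** Induction on [m], following a nonzero class. The hypothesis gives
    vanishing for the cokernel, that is, for the union of the proper faces;
    the submodule of [split_faces_top] is a translate by one degree of the
    face of [x0 |: D], and [face_depth] makes its homology inject into that of
    the union. For [m = 0] the union is the single face of [x0 |: D] without
    translation, and [face_not_acyclic0] concludes. *)
Lemma face_not_acyclic m k D : #|X :\: D| = m.+1 -> D \subset X -> (k + m.+2 = q)%N ->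
  ~ (forall al, tdeg al = q%:Z - 2 -> acyclic (face D set0) k al).
Proof.
elim: m k D => [|m IH] k D Dm DX kq h.
all: have [x0 x0D] : exists x0, x0 \in X :\: D by apply/set0Pn; rewrite -cards_eq0 Dm.
all: have D0 : X :\: D != set0 by rewrite -cards_eq0 Dm.
all: have DX' : x0 |: D \subset X by
  move: x0D; rewrite inE subUset sub1set DX => /andP[_ ->].
all: have [z Cz] := exists_cover (downset_all D) DX.
all: have Dm' := card_compl_add Dm x0D.
all: have cokA al : tdeg al = q%:Z - 1 -> acyclic (faces D set0 (X :\: D)) k.+1 al.
1,3: move=> dal; rewrite -[al](subrK (cover_point z)).
1,2: apply: (acyclic_ext (cok_mul_face (downset_all D) DX Cz D0)).
1,2: apply: (cok_mul_acyclic (@face_convex _ _) (face_add DX Cz)).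
1,3: by apply: h; rewrite !pointE dal; lia.
1,2: by apply: (face_depth Dm DX).1; lia.
- apply: (face_not_acyclic0 DX'); first by apply/eqP; rewrite -cards_eq0 Dm'.
  move=> al dal; have -> : q.-1 = k.+1 by lia.
  apply: acyclic_ext (cokA al dal) => ga.
  have XD : X :\: D = [set x0].
    apply/esym/eqP; rewrite eqEcard sub1set x0D cards1 Dm.
    by [].
  rewrite XD; apply/facesP/faceP => [[f [x /set1P -> e]]|[c e l]].
    split; [exact: (face_cone f)| |exact: (face_lt f)].
    by move=> u; rewrite !inE => /predU1P[-> //|]; apply: (face_eq f).
  split; last by exists x0; rewrite ?inE // e ?setU11.
  by split=> // u uD; apply: e; rewrite inE uD orbT.
apply: (IH k.+1 (x0 |: D) Dm' DX'); first by lia.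
move=> al dal; have [z' Cz'] := exists_cover (downset_all (x0 |: D)) DX'.
have XDx : X :\: (x0 |: D) = (X :\: D) :\ x0 by rewrite setDDl setUC.
have D0' : X :\: (x0 |: D) != set0 by rewrite -cards_eq0 Dm'.
have [y yD] := set0Pn _ D0'.
(* the class lives on the face of [x0 |: D] without its proper faces, a
   translate of that face *)
have sh : acyclic (face (x0 |: D) (X :\: (x0 |: D))) k.+1 (al + cover_point z').
  have spl := @split_faces_top D (X :\: (x0 |: D)) x0.
  have x0n : x0 \notin X :\: (x0 |: D) by rewrite XDx !inE eqxx.
  apply: (acyclic_sub (@faces_convex _ _ _) (spl x0n)).
    by apply: (face_depth Dm DX).2; rewrite ?XDx ?subsetDl -?XDx //; lia.
  rewrite XDx setD1K //; apply: cokA; rewrite !pointE dal; lia.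
apply: (@acyclic_shift _ _ _ _ _ (face (x0 |: D) (X :\: (x0 |: D))) (- cover_point z')).
  move=> ga; rewrite opprK; apply/idP/idP => [f|f].
    have /faceP[c e _] := face_add DX' Cz' f; apply/faceP; split=> // x xD.
    have /faceP[c' _ _] := f; have := cone_le x c'; move: xD; rewrite !pointE Cz' inE.
    by move=> /andP[/negbTE -> ->] /=; lia.
  rewrite -[ga](addrK (cover_point z')); apply: (face_sub _ _ Cz' _ f) => //; first exact: downset_all.
  by have /faceP[c _ l] := f; apply: le_lt_trans (l y yD); apply: cone_pos c _.
by rewrite opprK.
Qed.

End Antichain.
End Cone.

(** * From multidegrees to toric rings *)

Section Transfer.
Variables (K : fieldType) (n q : nat) (v : 'I_q -> 'X_{1..n}).
Local Notation T := {mpoly K[q]}.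
Local Notation toric := (@toric_map K n q v).

HB.instance Definition _ := GRing.RMorphism.on (@toric_map K n q v).

Definition toric_exp (m : 'X_{1..q}) : 'X_{1..n} := [multinom (\sum_j v j x * m j)%N | x < n].

Lemma toricX m : toric 'X_[m] = xt_mon K (toric_exp m) (mdeg m).
Proof.
rewrite /toric_map mmapX /mmap1 /xt_mon.
rewrite (eq_bigr (fun j => 'X_[v j *+ m j] *: 'X^(m j))); last first.
  by move=> j _; rewrite exprZn mpolyXn -exprM mul1n.
rewrite scaler_prod prodrXr -mdegE; congr (_ *: _).
rewrite -(big_morph _ (mpolyXD K) (mpolyX0 _ _)); congr 'X_[_].
apply/mnmP => x; rewrite mnm_sumE mnmE; apply: eq_bigr => j _.
by elim: (m j) => [|k IH]; rewrite ?muln0 ?mulmS ?mnmDE ?IH ?mulnS // mnm0E.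
Qed.

Lemma toricC (c : K) : toric c%:MP = c%:MP%:P.
Proof. by rewrite /toric_map mmapC. Qed.

Definition gen_point j : point n := ([ffun x => (v j x)%:Z], 1).

Definition mon_point m : point n := ([ffun x => (toric_exp m x)%:Z], (mdeg m)%:Z).

Lemma mon_pointD m i : mon_point (U_(i) + m)%MM = mon_point m + gen_point i.
Proof.
congr (_, _); last by rewrite mdegD mdeg1 addrC.
apply/ffunP => x; rewrite !ffunE !mnmE -PoszD; congr Posz.
rewrite (eq_bigr (fun j => v j x * m j + v j x * (i == j))%N); last first.
  by move=> j _; rewrite mnmDE mnm1E -mulnDr addnC.
rewrite big_split /=; congr (_ + _)%N.
rewrite (bigD1 i) //= eqxx muln1 big1 ?addn0 // => j /negbTE ji.
by rewrite eq_sym ji muln0.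
Qed.

(** The coefficient of [x^a t^b] in the image of [p], where [ga = (a, b)];
    zero at points with a negative coordinate. *)
Definition toric_coef (ga : point n) (p : T) : K :=
  if [forall x, 0 <= coord ga x] && (0 <= tdeg ga) then
    ((toric p)`_(`|tdeg ga|%N))@_[multinom `|coord ga x|%N | x < n]
  else 0.

Lemma toricL c p p' : toric (c *: p + p') = c%:MP%:P * toric p + toric p'.
Proof. by rewrite rmorphD /= /toric_map mmapZ. Qed.

Lemma toric_coef_is_linear ga : linear_for *%R (toric_coef ga).
Proof.
move=> c p p'; rewrite /toric_coef toricL; case: ifP => _.
  by rewrite coefD coefCM mcoeffD mcoeffCM.
by rewrite mulr0 addr0.
Qed.
HB.instance Definition _ ga := GRing.isLinear.Build K T K *%R (toric_coef ga) (toric_coef_is_linear ga).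

Lemma toric_coefX ga m : toric_coef ga 'X_[m] = (mon_point m == ga)%:R.
Proof.
rewrite /toric_coef toricX /xt_mon coefZ coefXn; case: ifP => [/andP[/forallP h0 d0]|h].
  rewrite mulr_natr mcoeffMn mcoeffX -mulrnA mulnb; congr (_%:R); congr (nat_of_bool _).
  apply/andP/eqP => [[/eqP/mnmP e /eqP d]|<-].
    case: ga h0 d0 e d => a d /= h0 d0 e /=; rewrite /tdeg /= in d0 *; move=> e'.
    congr (_, _); last by rewrite -e' gez0_abs.
    apply/ffunP => x; rewrite ffunE e mnmE; have := h0 x; rewrite /coord /= => h.
    by rewrite gez0_abs.
  by split=> //; apply/eqP/mnmP => x; rewrite mnmE /coord /= ffunE absz_nat.
case: eqP => // e; case/negP: h; rewrite -e /coord /tdeg /= andbT; apply/forallP => x.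
by rewrite ffunE.
Qed.

Lemma toric_coefM ga i p : toric_coef ga ('X_i * p) = toric_coef (ga - gen_point i) p.
Proof.
rewrite (mpolyE p) mulr_sumr !linear_sum; apply: eq_bigr => m _.
rewrite -scalerAr !linearZ /= -mpolyXD !toric_coefX mon_pointD.
by rewrite -[in RHS](inj_eq (addIr (gen_point i))) subrK.
Qed.

Lemma toric_coef_supp ga p : toric_coef ga p != 0 -> exists2 m, p@_m != 0 & mon_point m = ga.
Proof.
move=> nz; have [/hasP[m mp /eqP e]|/hasPn h] := boolP (has (fun m => mon_point m == ga) (msupp p)).
  by exists m => //; rewrite -mcoeff_msupp.
case/eqP: nz; rewrite (mpolyE p) linear_sum big_seq big1 //= => m /h /negbTE e.
by rewrite linearZ /= toric_coefX e mulr0.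
Qed.

Lemma toric_eq0 p : (forall ga, toric_coef ga p = 0) -> toric p = 0.
Proof.
move=> h; apply/polyP => d; apply/mpolyP => a; rewrite coef0 mcoeff0.
pose g : point n := ([ffun x => (a x)%:Z], d%:Z).
have g0 : [forall x, 0 <= coord g x] && (0 <= tdeg g).
  by rewrite andbT; apply/forallP => x; rewrite /coord ffunE.
have := h g; rewrite /toric_coef g0.
have -> : [multinom `|coord g x|%N | x < n] = a by apply/mnmP => x; rewrite mnmE /coord ffunE.
by [].
Qed.

Lemma toric_coef_eq0 ga p : toric p = 0 -> toric_coef ga p = 0.
Proof. by move=> h; rewrite /toric_coef h coef0 mcoeff0; case: ifP. Qed.

Local Notation kosT := (@koszul q T (fun i => 'X_i) T^o).
Local Notation kosK := (@koszul q K (fun=> 1) K^o).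

(** The part of multidegree [al] of a chain with polynomial values, read
    through the toric map. *)
Definition mcomponent al (c : {set 'I_q} -> T) (S : {set 'I_q}) : K^o := toric_coef (cdeg gen_point al S) (c S).

(** Multiplication by the variable [i] translates coefficients by [gen_point
    i], so the Koszul complex of the toric ring is the direct sum of the
    scalar complexes of all multidegrees. *)
Lemma mcomponent_koszul al c S : mcomponent al (kosT c) S = kosK (mcomponent al c) S.
Proof.
rewrite /mcomponent /koszul linear_sum; apply: eq_bigr => i iS.
rewrite (cdeg_add _ _ iS) /GRing.scale /= mulr1 -mulrA.
have -> : (-1) ^+ rank_in i S = ((-1) ^+ rank_in i S)%:MP :> T.
  by rewrite rmorphXn /= rmorphN /= rmorph1.
by rewrite mul_mpolyC linearZ /= toric_coefM addrK.
Qed.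

Lemma mcomponentB al c c' S : mcomponent al (fun S => c S - c' S) S = mcomponent al c S - mcomponent al c' S.
Proof. by rewrite /mcomponent linearB. Qed.

Lemma mcomponent_eq0 c S : (forall al, mcomponent al c S = 0) -> toric (c S) = 0.
Proof.
move=> h; apply: toric_eq0 => ga; have := h (ga + \sum_(i in S) gen_point i).
by rewrite /mcomponent /cdeg addrK.
Qed.

Variable Q : pred (point n).
Hypothesis QE : forall ga, Q ga <-> exists m, mon_point m = ga.

Lemma Q_up ga i : Q ga -> Q (ga + gen_point i).
Proof. by move=> /QE[m <-]; apply/QE; exists (U_(i) + m)%MM; rewrite mon_pointD. Qed.

Lemma toric_coef_support ga p : toric_coef ga p != 0 -> Q ga.
Proof. by move=> /toric_coef_supp[m _ e]; apply/QE; exists m. Qed.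

Definition poly_chain k d (c : {set 'I_q} -> T) :=
  forall S m, (c S)@_m != 0 -> #|S| = k /\ (k + mdeg m = d)%N.

Lemma mcomponent_chain k d al c : poly_chain k d c ->
  mchain gen_point Q k al (mcomponent al c) /\ (tdeg al != d%:Z -> forall S, mcomponent al c S = 0).
Proof.
move=> hc; have h S : mcomponent al c S != 0 -> [/\ #|S| = k, Q (cdeg gen_point al S) & tdeg al = d%:Z].
  move=> nz; have Qp := toric_coef_support nz; have [m /hc[Sk md] e] := toric_coef_supp nz; split=> //.
  by have := @tdeg_cdeg _ _ gen_point al S (fun=> erefl); rewrite -e /tdeg /= -/(tdeg al) Sk -md; lia.
split=> [S /h[]//|ne S]; apply/eqP; apply: contraNT ne => /h[_ _ ->].
by rewrite eqxx.
Qed.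

(** The set [Q] being stable under translation by the generators, chains
    supported on [Q] have their full differential supported on [Q]. *)
Lemma bd_notin k al (b : {set 'I_q} -> K^o) S : mchain gen_point Q k al b ->
  ~~ Q (cdeg gen_point al S) -> kosK b S = 0.
Proof.
move=> hb nQ; apply: bd_eq0 => i iS; apply/eqP; apply: contraNT nQ => /hb[_].
by rewrite (cdeg_add _ _ iS); apply: Q_up.
Qed.

(** Each point of [Q] is lifted to a monomial once and for all, so that scalar
    chains become chains of polynomials. *)
Lemma lift_exists : exists f : point n -> 'X_{1..q}, forall ga, Q ga -> mon_point (f ga) = ga.
Proof.
have h ga : exists m, Q ga -> mon_point m = ga.
  by have [/QE[m e]|nQ] := boolP (Q ga); [exists m|exists 0%MM].
by have [f fE] := boolp.choice h; exists f.
Qed.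

(** A cycle of the toric ring has finitely many nonzero components; each
    bounds in its own multidegree, and the lifts of the bounding chains add up
    to a bounding chain. *)
Lemma transfer k d c : (forall al, tdeg al = d%:Z -> acyclic K gen_point Q k al) ->
  poly_chain k d c -> (forall S, toric (kosT c S) = 0) ->
  exists2 b, poly_chain k.+1 d b & forall S, toric (c S - kosT b S) = 0.
Proof.
move=> hQ hc cy; have [f fE] := lift_exists.
have [be beP] : exists be : point n -> {set 'I_q} -> K^o, forall al, tdeg al = d%:Z ->
    mchain gen_point Q k.+1 al (be al) /\
    forall S, Q (cdeg gen_point al S) -> mcomponent al c S = kosK (be al) S.
  suff h al : exists b, tdeg al = d%:Z -> mchain gen_point Q k.+1 al b /\
      forall S, Q (cdeg gen_point al S) -> mcomponent al c S = kosK b S.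
    by have [f' f'E] := boolp.choice h; exists f'.
  have [e|ne] := eqVneq (tdeg al) d%:Z; last by exists (fun=> 0) => e; rewrite e eqxx in ne.
  have [||b hb cb] := hQ al e (mcomponent al c); last by exists b.
    by case: (mcomponent_chain al hc).
  by move=> S _; rewrite -mcomponent_koszul /mcomponent toric_coef_eq0.
(* the multidegrees in which [c] has a nonzero component *)
pose As : seq (point n) := undup
  [seq (mon_point m + \sum_(i in U) gen_point i : point n)
  | U : {set 'I_q} <- enum predT, m : 'X_{1..q} <- msupp (c U)].
have out al S : al \notin As -> mcomponent al c S = 0.
  move=> nA; apply/eqP; apply: contraNT nA => /toric_coef_supp[m mc e].
  rewrite mem_undup; apply/allpairsPdep; exists S, m.
  by rewrite mem_enum mcoeff_msupp mc e /cdeg subrK.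
(* multidegrees of another level are discarded so that [b] is homogeneous *)
pose b (S : {set 'I_q}) : T := \sum_(al <- As | tdeg al == d%:Z) be al S *: 'X_[f (cdeg gen_point al S)].
have comp_b al S : mcomponent al b S = if (al \in As) && (tdeg al == d%:Z) then be al S else 0.
  have E al' : tdeg al' = d%:Z -> be al' S * (mon_point (f (cdeg gen_point al' S)) == cdeg gen_point al S)%:R
     = if al' == al then be al' S else 0.
    move=> e; have [->|nz] := eqVneq (be al' S) 0; first by rewrite mul0r if_same.
    have /fE -> := ((beP _ e).1 _ nz).2.
    by rewrite /cdeg (inj_eq (addIr _)); case: eqP; rewrite ?mulr1 ?mulr0.
  rewrite /mcomponent /b linear_sum /=.
  rewrite (eq_bigr (fun al' => if al' == al then be al' S else 0)); last first.
    by move=> al' /eqP /E <-; rewrite linearZ /= toric_coefX.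
  have [aA|aA] /= := boolP (al \in As).
    rewrite big_mkcond (bigD1_seq al) ?undup_uniq //= eqxx big1 ?addr0 //.
    by move=> al' /negbTE ->; rewrite if_same.
  rewrite big_seq_cond big1 // => al' /andP[aA' _].
  by case: eqP aA' aA => // -> ->.
exists b => [S m|S].
  rewrite /b raddf_sum /= => nz.
  have [al /andP[aA /eqP e] nz'] : exists2 al, (al \in As) && (tdeg al == d%:Z) &
      (be al S *: 'X_[f (cdeg gen_point al S)])@_m != 0.
    apply: contrapT => h; case/eqP: nz; rewrite big_seq_cond big1 // => al hal.
    by apply/eqP; apply: contrapT => /negP nz; apply: h; exists al.
  move: nz'; rewrite mcoeffZ mcoeffX mulf_eq0 negb_or => /andP[nz' fm].
  have [Sk Qp] := (beP _ e).1 _ nz'; split=> //.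
  have fm' : f (cdeg gen_point al S) = m by apply/eqP; apply: contraNT fm => /negbTE ->.
  have := congr1 (@tdeg n) (fE _ Qp); rewrite fm' tdeg_cdeg // Sk e /tdeg /=; lia.
apply: (mcomponent_eq0 (c := fun S => c S - kosT b S)) => al.
rewrite mcomponentB mcomponent_koszul.
have -> : kosK (mcomponent al b) S = kosK (if (al \in As) && (tdeg al == d%:Z) then be al else fun=> 0) S.
  by apply: eq_bd => i _; rewrite comp_b; case: ifP.
have [aA|aA] /= := boolP (al \in As); last by rewrite out // bd_eq0 ?subrr.
have [e|ne] := eqVneq (tdeg al) d%:Z; last first.
  by rewrite (mcomponent_chain al hc).2 // bd_eq0 ?subrr.
have [h1 h2] := beP al e; have [Qp|Qp] := boolP (Q (cdeg gen_point al S)).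
  by rewrite h2 // subrr.
rewrite (bd_notin h1) // subr0; apply/eqP; apply: contraNT Qp; exact: toric_coef_support.
Qed.

(** Conversely, the lift of a scalar cycle is a cycle of the toric ring
    concentrated in one multidegree, and the component of a bounding chain in
    that multidegree bounds. *)
Lemma transfer_rev k d al :
  (forall c, poly_chain k d c -> (forall S, toric (kosT c S) = 0) ->
    exists2 b, poly_chain k.+1 d b & forall S, toric (c S - kosT b S) = 0) ->
  tdeg al = d%:Z -> acyclic K gen_point Q k al.
Proof.
move=> H dal c hc cy; have [f fE] := lift_exists.
pose ct (S : {set 'I_q}) : T := c S *: 'X_[f (cdeg gen_point al S)].
have comp_ct al' S : mcomponent al' ct S = if al' == al then c S else 0.
  rewrite /mcomponent /ct linearZ /= toric_coefX.
  have [->|nz] := eqVneq (c S) 0; first by rewrite mul0r if_same.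
  have /fE -> := (hc _ nz).2.
  by rewrite /cdeg (inj_eq (addIr _)) eq_sym; case: eqP; rewrite ?mulr1 ?mulr0.
have [||b hb cb] := H ct.
- move=> S m; rewrite mcoeffZ mcoeffX mulf_eq0 negb_or => /andP[nz fm].
  have [Sk Qp] := hc _ nz; split=> //.
  have fm' : f (cdeg gen_point al S) = m by apply/eqP; apply: contraNT fm => /negbTE ->.
  have := congr1 (@tdeg n) (fE _ Qp); rewrite fm' tdeg_cdeg // Sk dal /tdeg /=; lia.
- move=> S; apply: (mcomponent_eq0 (c := kosT ct)) => al'; rewrite mcomponent_koszul.
  have [->|ne] := eqVneq al' al; last first.
    by rewrite bd_eq0 // => i _; rewrite comp_ct (negbTE ne).
  rewrite (@eq_bd _ _ _ c) => [|i _]; last by rewrite comp_ct eqxx.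
  have [/cy//|Qp] := boolP (Q (cdeg gen_point al S)).
  exact: bd_notin hc Qp.
exists (mcomponent al b); first by case: (mcomponent_chain al hb).
move=> S Qp; have := toric_coef_eq0 (cdeg gen_point al S) (cb S).
by rewrite linearB /= -!/(mcomponent _ _ _) comp_ct eqxx -mcomponent_koszul => /eqP; rewrite subr_eq0 => /eqP.
Qed.

End Transfer.

(** * Graded rows and dimension shifting *)

Section PolyAcyclic.
Variables (K : fieldType) (q : nat).
Local Notation T := {mpoly K[q]}.
Let v (j : 'I_q) : 'X_{1..q} := U_(j)%MM.
Local Notation unit_point := (gen_point v).
Local Notation kosT := (@koszul q T (fun i => 'X_i) T^o).

(** The polynomial ring is the toric ring of the unit vectors, whose points
    are those of the orthant. The equality with the level records that each
    generator has degree one. *)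
Definition orthant : pred (point q) := fun ga =>
  [forall x, 0 <= coord ga x] && (\sum_x coord ga x == tdeg ga).

Lemma toric_exp_unit m : toric_exp v m = m.
Proof.
apply/mnmP => x; rewrite mnmE (bigD1 x) //= mnm1E eqxx mul1n big1 ?addn0 // => j.
by rewrite mnm1E => /negbTE ->.
Qed.

Lemma orthantE ga : orthant ga <-> exists m, mon_point v m = ga.
Proof.
split=> [/andP[/forallP h /eqP e]|[m <-]].
  exists [multinom `|coord ga x|%N | x < q]; rewrite /mon_point toric_exp_unit.
  rewrite [RHS]surjective_pairing; congr (_, _).
    by apply/ffunP => x; rewrite ffunE mnmE gez0_abs //; apply: h.
  rewrite -/(tdeg ga) -e mdegE (big_morph _ PoszD (erefl _)); apply: eq_bigr => x _.
  by rewrite mnmE gez0_abs //; apply: h.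
rewrite /orthant /coord /tdeg /mon_point toric_exp_unit /=; apply/andP; split.
  by apply/forallP => x; rewrite ffunE.
rewrite mdegE (big_morph _ PoszD (erefl _)); apply/eqP; apply: eq_bigr => x _.
by rewrite ffunE.
Qed.

Lemma coord_cdeg al S x : coord (cdeg unit_point al S) x = coord al x - (x \in S)%:Z.
Proof.
rewrite /cdeg coordD coordN; congr (_ - _).
rewrite (@big_morph _ _ (fun g : point q => coord g x) 0 +%R 0 +%R) => [|g g'|]; first last.
- by rewrite /coord ffunE.
- exact: coordD.
rewrite (eq_bigr (fun j => (j == x)%:Z)); last by move=> j _; rewrite /coord ffunE mnm1E.
have [xS|xS] := boolP (x \in S).
  by rewrite (bigD1 x) //= eqxx big1 ?addr0 // => j /andP[_ /negbTE ->].
by rewrite big1 // => j jS; case: eqP => // e; rewrite -e jS in xS.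
Qed.

(** If some coordinate [i] of [al] is positive, exterior multiplication by [i]
    is a contracting homotopy in multidegree [al]. Otherwise only the empty
    set contributes, in degree zero. *)
Lemma orthant_acyclic k al : (0 < k)%N || (tdeg al != 0) -> acyclic K unit_point orthant k al.
Proof.
move=> kd; have [/existsP[i ai]|/existsPn h] := boolP [exists i, 0 < coord al i]; last first.
  move=> c hc cy; exists (fun=> 0) => [S|S _]; first by rewrite eqxx.
  rewrite [RHS]bd_eq0 //; apply/eqP; apply: contraT => /hc[Sk /andP[/forallP h0 /eqP e]].
  have h1 x : coord al x = 0 /\ (x \in S) = false.
    by have := h0 x; have := h x; rewrite coord_cdeg; case: (x \in S); lia.
  have S0 : S = set0 by apply/setP => x; rewrite inE (h1 x).2.
  case/orP: kd; first by rewrite -Sk S0 cards0.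
  move: e; rewrite big1 => [|x _]; last by rewrite coord_cdeg (h1 x).1 (h1 x).2.
  by rewrite tdeg_cdeg // S0 cards0 subr0 => <-; rewrite eqxx.
move=> c hc cy; exists (wedge i c).
  move=> S; rewrite /wedge; case: ifP => [iS|]; last by rewrite eqxx.
  rewrite scaler_eq0 negb_or => /andP[_] /hc[<- /andP[/forallP h0 /eqP e]].
  split; first by rewrite (cardsD1 i S) iS.
  apply/andP; split.
    apply/forallP => x; have := h0 x; rewrite !coord_cdeg !inE.
    by have [->|] := eqVneq x i => //=; rewrite iS; lia.
  move: e; rewrite (@cdeg_add _ _ _ al i (S :\ i)) ?inE ?eqxx // setD1K // tdegD.
  rewrite (eq_bigr (fun x => coord (cdeg unit_point al S) x + coord (unit_point i) x)); last by move=> *; rewrite coordD.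
  rewrite big_split (_ : \sum_x coord (unit_point i) x = 1) => [/addIr ->//|].
  rewrite (bigD1 i) //= /coord ffunE mnm1E eqxx big1 ?addr0 // => j ji.
  by rewrite ffunE mnm1E eq_sym (negbTE ji).
move=> S BS; have := koszul_wedge (fun=> 1) i c S.
rewrite scale1r => <-; rewrite [X in _ + X](_ : _ = 0) ?addr0 //.
rewrite /wedge; case: ifP => // iS; rewrite cy ?scaler0 //.
rewrite (@cdeg_add _ _ _ al i (S :\ i)) ?inE ?eqxx // setD1K //.
exact: (Q_up orthantE).
Qed.

Lemma toric_unit_inj (p : T) : toric_map v p = 0 -> p = 0.
Proof.
move=> h; apply/mpolyP => m; rewrite mcoeff0 -(toric_coef_eq0 (mon_point v m) h).
rewrite [in RHS](mpolyE p) linear_sum [in LHS](mpolyE p) raddf_sum; apply: eq_bigr => m' _.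
rewrite linearZ /= toric_coefX mcoeffZ mcoeffX; congr (_ * (nat_of_bool _)%:R).
apply/eqP/eqP => [->//|[e _]]; apply/mnmP => x.
by have /ffunP/(_ x) := e; rewrite !ffunE !toric_exp_unit => -[].
Qed.

(** The Koszul complex resolves the residue field, by [orthant_acyclic] in
    every multidegree. *)
Lemma poly_acyclic k d c : (0 < k)%N || (0 < d)%N -> poly_chain k d c ->
  (forall S, kosT c S = 0) -> exists2 b, poly_chain k.+1 d b & forall S, c S = kosT b S.
Proof.
move=> kd hc cy.
have [al dal|S|b hb cb] := transfer orthantE _ hc.
- by apply: orthant_acyclic; rewrite dal; case: (k) kd => //=; lia.
- by rewrite cy rmorph0.
by exists b => // S; apply/eqP; rewrite -subr_eq0; apply/eqP/toric_unit_inj.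
Qed.

End PolyAcyclic.

Section GradedRows.
Variables (K : fieldType) (q : nat).
Local Notation T := {mpoly K[q]}.
Local Notation kosT := (@koszul q T (fun i => 'X_i) T^o).
Local Notation kos := (koszul (fun i => 'X_i : T)).
Implicit Types (P : pred nat) (d k : nat).

(** A row [u] is an element of a free module with basis in degrees [s];
    [has_degrees P s u] says that its homogeneous components have degrees in
    [P]. *)
Definition has_degrees m P (s : 'I_m -> nat) (u : 'rV[T]_m) : Prop :=
  forall l mu, (u 0 l)@_mu != 0 -> P (s l + mdeg mu)%N.

(** Chains with values in a free module, of homological degree [k] and total
    degree [d], each exterior variable counting for one. *)
Definition row_chain m (s : 'I_m -> nat) k d (c : {set 'I_q} -> 'rV[T]_m) : Prop :=
  forall S l mu, (c S 0 l)@_mu != 0 -> #|S| = k /\ (k + (s l + mdeg mu) = d)%N.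

Definition graded_mx m' m (s' : 'I_m' -> nat) (s : 'I_m -> nat) (G : 'M[T]_(m', m)) : Prop :=
  forall i l mu, (G i l)@_mu != 0 -> (s l + mdeg mu = s' i)%N.

(** Membership in the irrelevant maximal ideal times the free module. *)
Definition no_constant m (u : 'rV[T]_m) : Prop := forall l, (u 0 l)@_0%MM = 0.

(** Vanishing of the [k]-th Koszul homology in degree [d] of the quotient of
    the free module by [Z]. *)
Definition quot_acyclic m (s : 'I_m -> nat) (Z : 'rV[T]_m -> Prop) k d : Prop :=
  forall c, row_chain s k d c -> (forall S, Z (kos c S)) ->
  exists2 b, row_chain s k.+1 d b & forall S, Z (c S - kos b S).

Lemma koszul_row m (c : {set 'I_q} -> 'rV[T]_m) S l : kos c S 0 l = kosT (fun S => c S 0 l) S.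
Proof. by rewrite /koszul summxE; apply: eq_bigr => i _; rewrite mxE. Qed.

(** Coordinate by coordinate this is [poly_acyclic]. In homological degree
    zero, it says that a homogeneous row without constant terms is a
    combination of the variables. *)
Lemma row_acyclic m (s : 'I_m -> nat) k d c : row_chain s k d c -> (forall S, kos c S = 0) ->
  (0 < k)%N \/ (forall S, no_constant (c S)) ->
  exists2 b, row_chain s k.+1 d b & forall S, c S = kos b S.
Proof.
move=> hc cy pos.
have [b bP] : exists b : 'I_m -> {set 'I_q} -> T, forall l,
    (forall S mu, (b l S)@_mu != 0 -> #|S| = k.+1 /\ (k.+1 + (s l + mdeg mu) = d)%N)
    /\ forall S, c S 0 l = kosT (b l) S.
  suff h l : exists b : {set 'I_q} -> T,
    (forall S mu, (b S)@_mu != 0 -> #|S| = k.+1 /\ (k.+1 + (s l + mdeg mu) = d)%N)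
    /\ forall S, c S 0 l = kosT b S.
    by have [f fE] := boolp.choice h; exists f.
  have [/existsP[S0 c0]|/existsPn c0] := boolP [exists S, c S 0 l != 0]; last first.
    exists (fun=> 0); split=> [S mu|S]; first by rewrite mcoeff0 eqxx.
    rewrite /koszul big1 => [|i _]; last by rewrite scaler0.
    by apply/eqP; rewrite -[_ == _]negbK; apply: c0.
  have [sd kd] : (s l <= d)%N /\ ((0 < k) || (0 < d - s l))%N.
    have [mu nz] : exists mu, (c S0 0 l)@_mu != 0.
      apply: contrapT => h; case/eqP: c0; apply/mpolyP => mu; rewrite mcoeff0.
      by apply/eqP; apply: contrapT => /negP nz; apply: h; exists mu.
    have [Sk e] := hc _ _ _ nz; split; first by lia.
    case: pos => [->//|ps]; have : mu != 0%MM.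
      by apply: contraNneq nz => ->; rewrite ps.
    by rewrite -mdeg_eq0; lia.
  have [S mu||b hb cb] := @poly_acyclic K q k (d - s l) (fun S => c S 0 l) kd.
  - by move=> /hc[Sk e]; split=> //; lia.
  - by move=> S; rewrite -koszul_row cy mxE.
  by exists b; split=> // S mu /hb[Sk e]; split=> //; lia.
exists (fun S => \row_l b l S) => [S l mu|S].
  by rewrite mxE => /(bP l).1.
apply/rowP => l; rewrite koszul_row (bP l).2; apply: eq_bigr => i _.
by rewrite mxE.
Qed.

Lemma mcoeffM_neq0 (p h : T) mu : (p * h)@_mu != 0 ->
  exists m1 m2, [/\ p@_m1 != 0, h@_m2 != 0 & mu = (m1 + m2)%MM].
Proof.
rewrite -mcoeff_msupp => /msuppM_le /allpairsP[[m1 m2] /= [h1 h2 ->]].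
by exists m1, m2; rewrite -!mcoeff_msupp.
Qed.

Lemma mcoeff_sum_neq0 (I : finType) (P : pred I) (F : I -> T) mu :
  (\sum_(i | P i) F i)@_mu != 0 -> exists2 i, P i & (F i)@_mu != 0.
Proof.
rewrite raddf_sum /= => nz.
have [/existsP[i /andP[]]|/existsPn n] := boolP [exists i, P i && ((F i)@_mu != 0)].
  by exists i.
case/eqP: nz; rewrite big1 // => i Pi.
by have := n i; rewrite Pi /= negbK => /eqP.
Qed.

Lemma has_degrees_mul m' m (s' : 'I_m' -> nat) (s : 'I_m -> nat) G P w :
  graded_mx s' s G -> has_degrees P s' w -> has_degrees P s (w *m G).
Proof.
move=> hG hw l mu; rewrite mxE => /mcoeff_sum_neq0[i _ /mcoeffM_neq0[m1 [m2 [h1 h2 ->]]]].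
by rewrite mdegD addnCA (hG _ _ _ h2) addnC; apply: hw.
Qed.

Lemma row_chain_mul m' m (s' : 'I_m' -> nat) (s : 'I_m -> nat) G k d c :
  graded_mx s' s G -> row_chain s' k d c -> row_chain s k d (fun S => c S *m G).
Proof.
move=> hG hc S l mu; rewrite mxE => /mcoeff_sum_neq0[i _ /mcoeffM_neq0[m1 [m2 [h1 h2 ->]]]].
have [Sk <-] := hc _ _ _ h1; split=> //.
by have := hG _ _ _ h2; rewrite mdegD; lia.
Qed.

Lemma koszul_mul m' m (G : 'M[T]_(m', m)) (c : {set 'I_q} -> 'rV[T]_m') S :
  kos (fun S => c S *m G) S = kos c S *m G.
Proof. by rewrite /koszul mulmx_suml; apply: eq_bigr => i _; rewrite scalemxAl. Qed.

Lemma row_chainB m (s : 'I_m -> nat) k d c c' : row_chain s k d c -> row_chain s k d c' ->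
  row_chain s k d (fun S => c S - c' S).
Proof.
move=> hc hc' S l mu; rewrite !mxE mcoeffB.
have [->|/hc//] := eqVneq ((c S 0 l)@_mu) 0.
by rewrite sub0r oppr_eq0 => /hc'.
Qed.

Lemma row_chain_kos m (s : 'I_m -> nat) k d b : row_chain s k.+1 d b -> row_chain s k d (kos b).
Proof.
move=> hb S l mu; rewrite koszul_row => /mcoeff_sum_neq0[i iS].
rewrite /GRing.scale /= => /mcoeffM_neq0[m1 [m2 [h1 h2 ->]]].
have [] := hb _ _ _ h2; rewrite cardsU1 iS => -[<-] <-; split=> //.
suff e1 : mdeg m1 = 1%N by rewrite mdegD; lia.
move: h1; rewrite (_ : (-1) ^+ rank_in i S = ((-1) ^+ rank_in i S)%:MP :> T); last first.
  by rewrite rmorphXn /= rmorphN /= rmorph1.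
rewrite mul_mpolyC mcoeffZ mcoeffX mulf_eq0 negb_or => /andP[_].
by have [<-|_] := eqVneq U_(i)%MM m1; rewrite ?mdeg1 // eqxx.
Qed.

Definition deg_part P (p : T) : T := \sum_(mu <- msupp p | P (mdeg mu)) p@_mu *: 'X_[mu].

Lemma mcoeff_deg_part P p mu : (deg_part P p)@_mu = if P (mdeg mu) then p@_mu else 0.
Proof.
rewrite /deg_part raddf_sum /= big_mkcond /=.
have E m : (if P (mdeg m) then (p@_m *: 'X_[m])@_mu else 0) =
           if m == mu then (if P (mdeg mu) then p@_mu else 0) else 0.
  case: eqP => [->|ne]; first by rewrite mcoeffZ mcoeffX eqxx mulr1.
  by rewrite mcoeffZ mcoeffX; case: eqP => // _; rewrite mulr0 if_same.
rewrite (eq_bigr _ (fun m _ => E m)).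
have [h|h] := boolP (mu \in msupp p).
  rewrite (bigD1_seq mu) ?msupp_uniq //= eqxx big1 ?addr0 //.
  by move=> m /negbTE ->.
rewrite big_seq big1 => [|m mp]; last by case: eqP => // e; rewrite -e mp in h.
by move: h; rewrite mcoeff_msupp negbK => /eqP ->; rewrite if_same.
Qed.

Definition hcomponent m (s : 'I_m -> nat) d (u : 'rV[T]_m) : 'rV[T]_m :=
  \row_l deg_part (fun e => s l + e == d)%N (u 0 l).

Lemma mcoeff_hcomponent m (s : 'I_m -> nat) d u l mu :
  (hcomponent s d u 0 l)@_mu = if (s l + mdeg mu == d)%N then (u 0 l)@_mu else 0.
Proof. by rewrite mxE mcoeff_deg_part. Qed.

Lemma rowP_coef m (u w : 'rV[T]_m) : (forall l mu, (u 0 l)@_mu = (w 0 l)@_mu) -> u = w.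
Proof. by move=> h; apply/rowP => l; apply/mpolyP => mu. Qed.

Lemma hcomponentD m (s : 'I_m -> nat) d u w : hcomponent s d (u + w) = hcomponent s d u + hcomponent s d w.
Proof.
apply: rowP_coef => l mu; rewrite mcoeff_hcomponent.
have -> : ((hcomponent s d u + hcomponent s d w) 0 l)@_mu = (hcomponent s d u 0 l)@_mu + (hcomponent s d w 0 l)@_mu.
  by rewrite mxE mcoeffD.
by rewrite !mcoeff_hcomponent mxE mcoeffD; case: ifP; rewrite ?addr0.
Qed.

Lemma hcomponent_degrees m (s : 'I_m -> nat) d u : has_degrees (pred1 d) s (hcomponent s d u).
Proof. by move=> l mu; rewrite mcoeff_hcomponent /=; case: ifP => //; rewrite eqxx. Qed.

Lemma hcomponent_id m (s : 'I_m -> nat) d u : has_degrees (pred1 d) s u -> hcomponent s d u = u.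
Proof.
move=> h; apply: rowP_coef => l mu; rewrite mcoeff_hcomponent; case: ifPn => // ne.
by apply/esym/eqP; apply: contraNT ne => /h.
Qed.

Lemma hcomponent_eq0 m (s : 'I_m -> nat) d u : has_degrees (predC1 d) s u -> hcomponent s d u = 0.
Proof.
move=> h; apply: rowP_coef => l mu; rewrite mcoeff_hcomponent mxE mcoeff0.
by case: eqP => // e; apply/eqP; apply: contraT => /h /=; rewrite e eqxx.
Qed.

Lemma hcomponent_rest m (s : 'I_m -> nat) d u : has_degrees (predC1 d) s (u - hcomponent s d u).
Proof.
move=> l mu; rewrite !mxE mcoeffB mcoeff_deg_part /=.
by case: ifP => // _; rewrite subrr eqxx.
Qed.

Lemma hcomponent_mul m' m (s' : 'I_m' -> nat) (s : 'I_m -> nat) G d w :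
  graded_mx s' s G -> hcomponent s d (w *m G) = hcomponent s' d w *m G.
Proof.
move=> hG; rewrite -{1}(subrK (hcomponent s' d w) w) mulmxDl hcomponentD.
rewrite (hcomponent_eq0 (has_degrees_mul hG (@hcomponent_rest _ _ _ _))) add0r hcomponent_id //.
exact: has_degrees_mul hG (@hcomponent_degrees _ _ _ _).
Qed.

Definition graded_submod m (s : 'I_m -> nat) (Z : 'rV[T]_m -> Prop) : Prop :=
  [/\ Z 0, forall u w, Z u -> Z w -> Z (u + w), forall p u, Z u -> Z (p *: u)
    & forall d u, Z u -> Z (hcomponent s d u)].

Lemma graded_submodB m (s : 'I_m -> nat) Z u w : graded_submod s Z -> Z u -> Z w -> Z (u - w).
Proof. by case=> _ D sc _ Zu Zw; apply: D => //; rewrite -scaleN1r; apply: sc. Qed.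

Lemma graded_submod_sum m (s : 'I_m -> nat) Z (I : finType) (P : pred I) (F : I -> 'rV[T]_m) :
  graded_submod s Z -> (forall i, P i -> Z (F i)) -> Z (\sum_(i | P i) F i).
Proof. by case=> Z0 D _ _ h; elim/big_ind: _ => //. Qed.

Lemma graded_submod_ker m' m (s' : 'I_m' -> nat) (s : 'I_m -> nat) G :
  graded_mx s' s G -> graded_submod s' (fun w => w *m G = 0).
Proof.
move=> hG; split=> [|u w hu hw|p u hu|d u hu]; first by rewrite mul0mx.
- by rewrite mulmxDl hu hw addr0.
- by rewrite -scalemxAl hu scaler0.
- by rewrite -(hcomponent_mul _ _ hG) hu; apply: hcomponent_eq0 => l mu; rewrite mxE mcoeff0 eqxx.
Qed.

(** The exact sequence [0 -> ker G -> F' -> F -> F / Z -> 0], with [Z] the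
    image of [G], in both directions. The free modules have no higher Koszul
    homology. *)
Section Shift.
Variables (m' m : nat) (s' : 'I_m' -> nat) (s : 'I_m -> nat) (G : 'M[T]_(m', m)).
Variable Z : 'rV[T]_m -> Prop.
Hypotheses (hG : graded_mx s' s G) (ZE : forall u, Z u <-> exists w, u = w *m G).

(** Preimages under a graded matrix may be chosen homogeneous, by taking
    components. *)
Lemma lift_hom (c : {set 'I_q} -> 'rV[T]_m) k d : (forall S, Z (c S)) -> row_chain s k d c ->
  exists2 w, row_chain s' k d w & forall S, c S = w S *m G.
Proof.
move=> hZ hc; have h S : exists w, c S = w *m G by apply/ZE.
have [f fE] := boolp.choice h.
exists (fun S : {set 'I_q} => if #|S| == k then (if (k <= d)%N then hcomponent s' (d - k) (f S) else 0) else 0).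
  move=> S l mu; case: (#|S| =P k) => [Sk|_]; last by rewrite mxE mcoeff0 eqxx.
  case: (leqP k d) => [kd|_]; last by rewrite mxE mcoeff0 eqxx.
  by move=> /hcomponent_degrees /= /eqP e; split=> //; lia.
move=> S; case: (#|S| =P k) => [Sk|Sk]; last first.
  rewrite mul0mx; apply: rowP_coef => l mu; rewrite mxE mcoeff0.
  by apply/eqP; apply: contraT => /hc[].
case: ifPn => [kd|kd].
  rewrite -(hcomponent_mul _ _ hG) -fE hcomponent_id // => l mu /hc[_ e] /=.
  by apply/eqP; lia.
rewrite mul0mx; apply: rowP_coef => l mu; rewrite mxE mcoeff0.
by apply/eqP; apply: contraT => /hc[_ e]; lia.
Qed.

(** The image of a cycle modulo [ker G] is a cycle of [F], hence the boundary
    of a chain [b], which is a cycle modulo [Z]; correcting [b] by a boundary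
    puts it in [Z], and a lift of it to [F'] bounds the initial cycle. *)
Lemma shift_down k d : quot_acyclic s Z k.+2 d -> quot_acyclic s' (fun w => w *m G = 0) k.+1 d.
Proof.
move=> H c hc cy.
have [S|//|b hb cb] := @row_acyclic m s k.+1 d _ (row_chain_mul hG hc).
- by rewrite koszul_mul cy.
- by left.
have [S|e he eb] := H b hb; first by rewrite -cb; apply/ZE; exists (c S).
have hz : row_chain s k.+2 d (fun S => b S - kos e S) := row_chainB hb (row_chain_kos he).
have [w hw ew] := lift_hom eb hz.
exists w => // S; rewrite mulmxBl -koszul_mul.
rewrite -(koszul_ext _ ew) koszulB koszul_koszul subr0 -cb.
by rewrite subrr.
Qed.

Lemma shift_up k d : quot_acyclic s' (fun w => w *m G = 0) k d -> quot_acyclic s Z k.+1 d.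
Proof.
move=> H c hc cy; have [w hw ew] := lift_hom cy (row_chain_kos hc).
have [S|b hb cb] := H w hw.
  by rewrite -koszul_mul -(koszul_ext _ ew) koszul_koszul.
have hd : row_chain s k.+1 d (fun S => c S - b S *m G) := row_chainB hc (row_chain_mul hG hb).
have [S|//|e he ce] := row_acyclic hd.
- rewrite koszulB koszul_mul ew; have := cb S; rewrite mulmxBl => /eqP.
  by rewrite subr_eq0 => /eqP ->; rewrite subrr.
- by left.
exists e => // S; apply/ZE; exists (b S); rewrite -ce.
by rewrite opprB addrC subrK.
Qed.

End Shift.

(** A quotient of a free module without generator in degree [d] has no minimal
    generator in degree [d]. *)
Lemma quot_acyclic0 m (s : 'I_m -> nat) Z d : Z 0 -> (forall l, s l != d) -> quot_acyclic s Z 0 d.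
Proof.
move=> Z0 hs c hc cy.
have [S|//|b hb cb] := row_acyclic hc.
- rewrite /koszul big1 // => i iS; apply: rowP_coef => l mu; rewrite !mxE mcoeff0.
  have [->|/eqP] := eqVneq (c (i |: S) 0 l) 0; first by rewrite mulr0 mcoeff0.
  case; apply/mpolyP => nu; rewrite mcoeff0; apply/eqP; apply: contraT => /hc[].
  by rewrite cardsU1 iS.
- right=> S l; apply/eqP; apply: contraT => /hc[_].
  by rewrite mdeg0 addn0 add0n => e; have := hs l; rewrite e eqxx.
by exists b => // S; rewrite cb subrr.
Qed.

(** The case of homological degree zero of [shift_down]: minimal generators of
    [Z] in degree [d] are classes in the first homology of [F / Z], because
    [Z] is contained in the maximal ideal times [F]. *)
Lemma decompose_of_quot_acyclic m (s : 'I_m -> nat) Z d u : graded_submod s Z -> (forall u, Z u -> no_constant u) ->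
  quot_acyclic s Z 1 d -> Z u -> has_degrees (pred1 d) s u ->
  exists z : 'I_q -> 'rV[T]_m, [/\ u = \sum_i 'X_i *: z i, forall i, Z (z i)
    & forall i, has_degrees (fun e => e.+1 == d) s (z i)].
Proof.
move=> gZ pZ H Zu hu; have [Z0 ZD Zs _] := gZ.
(* [u] seen as a chain of homological degree zero *)
pose c (S : {set 'I_q}) := if S == set0 then u else 0.
have hc : row_chain s 0 d c.
  move=> S l mu; rewrite /c; case: (S =P set0) => [->|_]; last by rewrite mxE mcoeff0 eqxx.
  by move=> /hu /eqP e; rewrite cards0.
have c0 i S : c (i |: S) = 0.
  by rewrite /c; case: (_ =P set0) => // e; have := setU11 i S; rewrite e inE.
have [S|//|b hb cb] := row_acyclic hc.
- by rewrite /koszul big1 // => i _; rewrite c0 scaler0.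
- right=> S; rewrite /c; case: (S =P set0) => _; first exact: pZ.
  by move=> l; rewrite mxE mcoeff0.
have [S|e he eb] := H b hb; first by rewrite -cb /c; case: (S =P set0).
exists (fun i => b [set i] - kos e [set i]); split=> // [|i].
  have := cb set0; rewrite {1}/c eqxx => ->.
  rewrite -[LHS]subr0 -{1}(koszul_koszul (fun i => 'X_i : T) e set0) -koszulB.
  apply: eq_big => [i|i _]; first by rewrite inE.
  rewrite setU0 (_ : rank_in i set0 = 0%N) ?mul1r //.
  by apply: eq_card0 => j; rewrite !inE.
move=> l mu; case/(row_chainB hb (row_chain_kos he)) => _ e1.
by apply/eqP; rewrite -e1.
Qed.

End GradedRows.

(** * Minimal free resolutions *)

Section Generators.
Variables (K : fieldType) (q : nat).
Local Notation T := {mpoly K[q]}.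
Variables (m : nat) (s : 'I_m -> nat) (Z : 'rV[T]_m -> Prop).
Hypothesis gZ : graded_submod s Z.

Definition homogeneous_family k (G : 'M[T]_(k, m)) (s' : 'I_k -> nat) :=
  graded_mx s' s G /\ forall i, Z (row i G).

Lemma family_mul k (G : 'M[T]_(k, m)) s' w : homogeneous_family G s' -> Z (w *m G).
Proof.
case=> _ hZ; have [_ _ sc _] := gZ; rewrite mulmx_sum_row.
by apply: (graded_submod_sum gZ) => i _; apply: sc.
Qed.

(** The elements of degree [d] embed in a finite dimensional space through
    their coefficients; a family of maximal rank spans. *)
Lemma degree_generators d : exists k (G : 'M[T]_(k, m)),
  homogeneous_family G (fun=> d) /\
  forall u, Z u -> has_degrees (pred1 d) s u -> exists w, u = w *m G.
Proof.
(* a monomial occurring in degree [d] has degree at most [d], whatever the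
   shift of its coordinate *)
pose J : finType := ('I_m * 'X_{1..q < d.+1})%type.
pose enc k (G : 'M[T]_(k, m)) : 'M[K]_(k, #|J|) :=
  \matrix_(i < k, j < #|J|)
    (let x : 'I_m * 'X_{1..q < d.+1} := @enum_val J predT j in (G i x.1)@_x.2).
pose P r := exists k (G : 'M[T]_(k, m)), homogeneous_family G (fun=> d) /\ \rank (enc k G) = r.
have P0 : exists r, `[< P r >].
  exists 0%N; apply/asboolP; exists 0%N, 0; split; last by apply/eqP; rewrite mxrank_eq0 flatmx0.
  by split=> [[]|[]].
have Pb r : `[< P r >] -> (r <= #|J|)%N.
  by move=> /asboolP[k [G [_ <-]]]; apply: rank_leq_col.
case: (ex_maxnP P0 Pb) => r /asboolP[k [G [hG rG]]] rmax; exists k, G; split=> // u Zu hu.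
have encU : enc _ (col_mx G u) = col_mx (enc _ G) (enc _ u).
  apply/matrixP => i j; rewrite -[i]splitK; case: (split i) => i' /=.
    by rewrite (col_mxEu (enc _ G)) [LHS]mxE [RHS]mxE /= col_mxEu.
  by rewrite (col_mxEd (enc _ G)) [LHS]mxE [RHS]mxE /= col_mxEd.
have hGu : homogeneous_family (col_mx G u) (fun=> d).
  split=> [i l mu|i].
    rewrite mxE; case: split => i'; first exact: hG.1.
    by rewrite (ord1 i') => /hu /eqP.
  have -> : row i (col_mx G u) = match split i with inl i' => row i' G | inr _ => u end.
    apply/rowP => l; rewrite !mxE; case: split => i'; by rewrite ?mxE // (ord1 i').
  by case: split => i' //; apply: hG.2.
have sub : (enc _ u <= enc _ G)%MS.
  have /asboolP/rmax : P (\rank (enc _ (col_mx G u))) by exists (k + 1)%N, (col_mx G u).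
  rewrite encU -addsmxE -rG => le.
  apply: submx_trans (addsmxSr (enc _ G) _) _.
  by rewrite -(geq_leqif (mxrank_leqif_sup (addsmxSl (enc _ G) (enc _ u)))).
have /submxP[x xE] := sub; pose w : 'rV[T]_k := \row_i (x 0 i)%:MP.
exists w; apply: rowP_coef => l mu.
have -> : ((w *m G) 0 l)@_mu = \sum_i x 0 i * (G i l)@_mu.
  rewrite mxE raddf_sum; apply: eq_bigr => i _.
  by rewrite mxE mul_mpolyC /= mcoeffZ.
have [e|ne] := eqVneq (s l + mdeg mu)%N d; last first.
  rewrite (_ : (u 0 l)@_mu = 0); last by apply/eqP; apply: contraNT ne => /hu.
  rewrite big1 // => i _; rewrite (_ : (G i l)@_mu = 0) ?mulr0 //.
  by apply/eqP; apply: contraNT ne => /hG.1 /eqP.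
have mud : (mdeg mu < d.+1)%N by lia.
have := congr1 (fun M : 'M[K]_(1, #|J|) => M 0 (enum_rank ((l, BMultinom mud) : J))) xE.
rewrite !mxE enum_rankK /= => ->.
by apply: eq_bigr => i _; rewrite mxE enum_rankK.
Qed.

Lemma bounded_generators D : exists k (G : 'M[T]_(k, m)) s',
  [/\ homogeneous_family G s', forall i, (s' i <= D)%N
    & forall d u, (d <= D)%N -> Z u -> has_degrees (pred1 d) s u -> exists w, u = w *m G].
Proof.
elim: D => [|D [k1 [G1 [s1 [h1 b1 g1]]]]].
  have [k [G [hG gG]]] := degree_generators 0; exists k, G, (fun=> 0%N); split=> //.
  by move=> d u; rewrite leqn0 => /eqP ->; apply: gG.
have [k2 [G2 [h2 g2]]] := degree_generators D.+1.
exists (k1 + k2)%N, (col_mx G1 G2), (fun i => match split i with inl i' => s1 i' | inr _ => D.+1 end).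
split=> [|i|d u].
- split=> [i l mu|i].
    by rewrite mxE; case: split => i'; [apply: h1.1|apply: h2.1].
  have -> : row i (col_mx G1 G2) = match split i with inl i' => row i' G1 | inr i' => row i' G2 end.
    by apply/rowP => l; rewrite !mxE; case: split => i'; rewrite mxE.
  by case: split => i'; [apply: h1.2|apply: h2.2].
- by case: split => i' //; apply: leqW.
rewrite leq_eqVlt ltnS => /predU1P[-> Zu /g2[]// w ->|dD Zu /g1[]// w ->].
  by exists (row_mx 0 w); rewrite mul_row_col mul0mx add0r.
by exists (row_mx w 0); rewrite mul_row_col mul0mx addr0.
Qed.

Lemma graded_generation k (G : 'M[T]_(k, m)) :
  (forall d u, Z u -> has_degrees (pred1 d) s u -> exists w, u = w *m G) ->
  forall u, Z u -> exists w, u = w *m G.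
Proof.
move=> hG u Zu; have [_ _ _ Zh] := gZ.
(* split off the homogeneous components from the top *)
have : exists N, has_degrees (fun e => e < N)%N s u.
  exists (\sum_l (s l + msize (u 0%R l)))%N => l mu nz.
  rewrite (bigD1 l) //=; have : (mdeg mu < msize (u 0%R l))%N.
    by apply: msize_mdeg_lt; rewrite mcoeff_msupp.
  by lia.
case=> N; elim: N u Zu => [|N IH] u Zu hu.
  exists 0; rewrite mul0mx; apply: rowP_coef => l mu; rewrite mxE mcoeff0.
  by apply/eqP; apply: contraT => /hu.
have [w1 e1] := hG N _ (Zh N u Zu) (@hcomponent_degrees _ _ _ _ _ _).
have [l mu nz|w2 e2] := IH (u - hcomponent s N u) (graded_submodB gZ Zu (Zh N u Zu)).
  have /= ne := hcomponent_rest nz; have : (u 0 l)@_mu != 0.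
    move: nz; rewrite !mxE mcoeffB mcoeff_deg_part; case: ifP => _; first by rewrite subrr eqxx.
    by rewrite subr0.
  by move=> /hu; rewrite ltnS leq_eqVlt (negbTE ne).
by exists (w2 + w1); rewrite mulmxDl -e1 -e2 subrK.
Qed.

Definition generates k (G : 'M[T]_(k, m)) (s' : 'I_k -> nat) D :=
  [/\ homogeneous_family G s', forall i, (s' i <= D)%N
    & forall u, Z u -> exists w, u = w *m G].

Lemma finite_generators D :
  (forall d u, (D < d)%N -> Z u -> has_degrees (pred1 d) s u ->
    exists z : 'I_q -> 'rV[T]_m, [/\ u = \sum_i 'X_i *: z i, forall i, Z (z i)
      & forall i, has_degrees (fun e => e.+1 == d) s (z i)]) ->
  exists k (G : 'M[T]_(k, m)) s', generates G s' D.
Proof.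
move=> hD; have [k [G [s' [hG bs gG]]]] := bounded_generators D.
exists k, G, s'; split=> //; apply: graded_generation.
elim=> [|d IH] u Zu hu; first exact: (gG 0%N).
have [le|lt] := leqP d.+1 D; first exact: (gG d.+1).
have [z [-> Zz hz]] := hD d.+1 u lt Zu hu.
have h i : exists w, z i = w *m G by apply: IH => // l mu /hz.
have [f fE] := boolp.choice h.
exists (\sum_i 'X_i *: f i); rewrite mulmx_suml; apply: eq_bigr => i _.
by rewrite fE scalemxAl.
Qed.

Lemma mulmx_col' k (G : 'M[T]_(k.+1, m)) (x : 'rV[T]_k.+1) i : x 0 i = 0 ->
  x *m G = col' i x *m row' i G.
Proof.
move=> x0; apply/rowP => l; rewrite !mxE (bigD1_ord i) //= x0 mul0r add0r.
by apply: eq_bigr => j _; rewrite !mxE.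
Qed.

(** In a generating family with the least number of elements there is no
    relation with a nonzero constant term: the component of such a relation in
    the degree of the corresponding generator has an invertible scalar as
    coefficient there, so that this generator could be dropped. *)
Lemma minimal_generators D : (exists k (G : 'M[T]_(k, m)) s', generates G s' D) ->
  exists k (G : 'M[T]_(k, m)) s', generates G s' D /\ forall w, w *m G = 0 -> no_constant w.
Proof.
move=> ex.
pose P k := `[< exists (G : 'M[T]_(k, m)) s', generates G s' D >].
have exP : exists k, P k by case: ex => k h; exists k; apply/asboolP.
case: (ex_minnP exP) => k /asboolP[G [s' gG]] kmin; exists k, G, s'; split=> // w wG i.
apply/eqP; apply: contraT => nz; exfalso.
case: k => [|k] in G s' gG kmin w wG i nz *; first by case: i nz.
have [[hG rG] bs gen] := gG.
(* only constants remain at the [i]-th entry of the component of degree [s'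
   i] *)
pose w' := hcomponent s' (s' i) w; set c := (w 0 i)@_0%MM in nz.
have w'G : w' *m G = 0 by rewrite -(hcomponent_mul _ _ hG) wG hcomponent_eq0 // => l mu; rewrite mxE mcoeff0 eqxx.
have w'i : w' 0 i = c%:MP.
  apply/mpolyP => mu; rewrite mcoeff_hcomponent mcoeffC -[X in _ == X]addn0 eqn_add2l mdeg_eq0.
  by rewrite eq_sym; case: eqP => [<-|_]; rewrite ?mulr1 ?mulr0.
have /kmin : P k; last by rewrite ltnn.
apply/asboolP; exists (row' i G), (s' \o lift i); split.
- split=> [j l mu|j]; first by rewrite mxE => /hG.
  have -> : row j (row' i G) = row (lift i j) G by apply/rowP => l; rewrite !mxE.
  exact: rG.
- by move=> j; apply: bs.
move=> u /gen[x ->].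
(* subtract the multiple of the relation that kills the [i]-th coefficient *)
exists (col' i (x - (x 0 i * (c^-1)%:MP) *: w')); rewrite -mulmx_col'.
  by rewrite mulmxBl -scalemxAl w'G scaler0 subr0.
by rewrite 3!mxE -/w' w'i -mulrA -mpolyCM mulVf // mulr1 subrr.
Qed.

End Generators.

Section Resolution.
Variables (K : fieldType) (q : nat).
Local Notation T := {mpoly K[q]}.

(** A stage of the resolution: a graded free module, together with the
    submodule that the next differential has to hit. *)
Record stage := Stage {
  st_rk : nat;
  st_s : 'I_st_rk -> nat;
  st_Z : 'rV[T]_st_rk -> Prop }.
Arguments st_s : clear implicits.
Arguments st_Z : clear implicits.

(** Here [r] is the regularity bound of the free module modulo [Z]. It grows
    by one at each step, which is the slope in the definition of regularity. *)
Definition good_stage r (st : stage) : Prop :=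
  [/\ graded_submod (st_s st) (st_Z st), forall u, st_Z st u -> no_constant u
    & forall k d, (k.+1 + r < d)%N -> quot_acyclic (st_s st) (st_Z st) k.+1 d].

Definition resolution_step r (st : stage) (x : {st' : stage & 'M[T]_(st_rk st', st_rk st)}) : Prop :=
  let st' := projT1 x in let G := projT2 x in
  [/\ graded_mx (st_s st') (st_s st) G, forall i, (st_s st' i <= r.+1)%N,
      forall u, st_Z st u <-> exists w, u = w *m G,
      st_Z st' = (fun w => w *m G = 0) & good_stage r.+1 st'].

Lemma resolution_step_exists r st : exists x, good_stage r st -> @resolution_step r st x.
Proof.
have [[gZ pZ hZ]|ng] := EM (good_stage r st); last first.
  by exists (existT (fun st' => 'M[T]_(st_rk st', st_rk st)) st (0 : 'M[T]_(st_rk st, st_rk st))) => /ng.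
have [|k [G [s' [[[hG rG] bs gen] min]]]] := @minimal_generators K q _ (st_s st) (st_Z st) r.+1.
  apply: (finite_generators gZ) => d u rd Zu hu.
  by apply: (decompose_of_quot_acyclic gZ pZ (hZ 0%N d _) Zu hu); rewrite add1n.
have ZE u : st_Z st u <-> exists w, u = w *m G.
  by split=> [/gen//|[w ->]]; apply: (family_mul gZ (s' := s')).
exists (existT (fun st' => 'M[T]_(st_rk st', st_rk st)) (Stage s' (fun w => w *m G = 0)) G) => _.
split=> //=; split=> //=; first exact: graded_submod_ker hG.
by move=> k' d kd; apply: (shift_down hG ZE); apply: hZ; lia.
Qed.

Variables (r0 : nat) (st0 : stage).

(** The ranks are only known once the generators are chosen, so the next stage
    and the matrix leading to it are chosen together. *)
Definition next_stage r st := sval (cid (resolution_step_exists r st)).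

Fixpoint res_stage j : stage :=
  if j is j'.+1 then projT1 (next_stage (r0 + j') (res_stage j')) else st0.

Definition res_map j : 'M[T]_(st_rk (res_stage j.+1), st_rk (res_stage j)) := projT2 (next_stage (r0 + j) (res_stage j)).

Hypothesis good0 : good_stage r0 st0.

Lemma res_stage_step j : good_stage (r0 + j) (res_stage j) -> resolution_step (r0 + j) (next_stage (r0 + j) (res_stage j)).
Proof. exact: (svalP (cid (resolution_step_exists (r0 + j) (res_stage j)))). Qed.

Lemma res_stage_good j : good_stage (r0 + j) (res_stage j).
Proof.
elim: j => [|j /res_stage_step[_ _ _ _]]; first by rewrite addn0.
by rewrite addnS.
Qed.

Lemma res_stage_shift j i : (forall i, st_s st0 i <= r0)%N -> (st_s (res_stage j) i <= r0 + j)%N.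
Proof.
move=> h0; case: j i => [|j] i; first by rewrite addn0.
by rewrite addnS; have [_ h _ _ _] := res_stage_step (res_stage_good j); apply: h.
Qed.

(** Repeated use of [shift_up], starting from [quot_acyclic0] at the stage
    where the homological degree is zero. *)
Lemma quot_acyclic_of_shifts g : (forall j i, (st_s (res_stage j) i).+1 < j + g)%N ->
  forall k j d, (d.+1 = k + j + g)%N -> quot_acyclic (st_s (res_stage j)) (st_Z (res_stage j)) k d.
Proof.
move=> hs; elim=> [|k IH] j d e.
  have [[Z0 _ _ _] _ _] := res_stage_good j; apply: quot_acyclic0 => // l.
  by have := hs j l; apply: contraTneq => ->; lia.
have [hG _ ZE Zj _] := res_stage_step (res_stage_good j).
apply: (shift_up hG ZE).
have := IH j.+1 d; rewrite /= Zj; apply; lia.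
Qed.

End Resolution.
Arguments st_s {K q} _ _.
Arguments st_Z {K q} _ _.

Section ToricRegularity.
Variables (K : fieldType) (n q : nat) (v : 'I_q -> 'X_{1..n}).
Local Notation T := {mpoly K[q]}.
Local Notation toric := (@toric_map K n q v).
Local Notation kosT := (@koszul q T (fun i => 'X_i) T^o).

(** Vanishing of the [k]-th Koszul homology of the toric ring in degree [d]. *)
Definition toric_acyclic k d := forall c, poly_chain k d c ->
  (forall S, toric (kosT c S) = 0) ->
  exists2 b, poly_chain k.+1 d b & forall S, toric (c S - kosT b S) = 0.

Definition toric_ker (u : 'rV[T]_1) : Prop := toric (u 0 0) = 0.

(** The toric map sends degree in the variables to degree in [t], so its
    kernel is graded. *)
Lemma toric_deg_part (p : T) d : toric p = 0 -> toric (deg_part (pred1 d) p) = 0.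
Proof.
move=> h; apply: toric_eq0 => ga.
have [e|ne] := eqVneq (tdeg ga) d%:Z.
  rewrite -(toric_coef_eq0 ga h) [in RHS](mpolyE p) !linear_sum [LHS]big_mkcond; apply: eq_bigr => m _.
  case: ifPn => // ne; rewrite linearZ /= toric_coefX; case: eqP => [E|_]; last by rewrite mulr0.
  by case/negP: ne; move: e; rewrite -E /tdeg /= => -[->].
rewrite linear_sum big1 //= => m /eqP md; rewrite linearZ /= toric_coefX.
by case: eqP => [E|_]; rewrite ?mulr0 //; case/eqP: ne; rewrite -E -md.
Qed.

Lemma toric_const (p : T) : toric p = 0 -> p@_0%MM = 0.
Proof.
move=> h; rewrite -(toric_coef_eq0 (mon_point v 0%MM) h).
rewrite [in RHS](mpolyE p) linear_sum [in LHS](mpolyE p) raddf_sum; apply: eq_bigr => m' _.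
rewrite linearZ /= toric_coefX mcoeffZ mcoeffX; congr (_ * (nat_of_bool _)%:R).
apply/eqP/eqP => [->//|/(congr1 (@tdeg n))]; rewrite /tdeg /= mdeg0 => -[/eqP].
by rewrite mdeg_eq0 => /eqP.
Qed.

Lemma graded_submod_toric : graded_submod (fun=> 0%N) toric_ker.
Proof.
rewrite /toric_ker; split=> [|u w hu hw|p u hu|d u hu]; first by rewrite mxE rmorph0.
- by rewrite mxE rmorphD /= hu hw addr0.
- by rewrite mxE rmorphM /= hu mulr0.
- by rewrite mxE; apply: toric_deg_part.
Qed.

Lemma quot_acyclic_toric k d : quot_acyclic (fun=> 0%N) toric_ker k d <-> toric_acyclic k d.
Proof.
have kosE (c : {set 'I_q} -> 'rV[T]_1) S : koszul (fun i => 'X_i : T) c S 0 0 = kosT (fun S => c S 0 0) S.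
  exact: koszul_row.
split=> H c hc cy.
  have [S l mu|S|b hb cb] := H (fun S => \row_(l < 1) c S).
  - by rewrite mxE => /hc.
  - rewrite /toric_ker kosE -(cy S); congr (toric _).
    by apply: eq_bigr => i _; rewrite mxE.
  exists (fun S => b S 0 0) => [S m /hb//|S].
  by have := cb S; rewrite /toric_ker !mxE -kosE.
have [S m /hc//|S|b hb cb] := H (fun S => c S 0 0).
  by rewrite -kosE; apply: cy.
exists (fun S => \row_(l < 1) b S) => [S l mu|S]; first by rewrite mxE => /hb.
rewrite /toric_ker -(cb S); congr (toric _); rewrite !mxE; congr (_ - _).
by rewrite kosE; apply: eq_bigr => i _; rewrite mxE.
Qed.

(** The resolution is started at the ring itself, a cyclic module, with the
    toric ideal as first kernel. The largest value of shift minus index exists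
    because it is bounded by [r] and the generator of the ring contributes
    [0]. The last clause is the lower bound: if all these values are less than
    [g.-1], Koszul homology vanishes in total degree [k + g - 1]. *)
Lemma toric_regularity r (S : {poly {mpoly K[n]}} -> Prop) :
  (forall f, S f <-> exists p, toric p = f) ->
  (forall k d, (k.+1 + r < d)%N -> toric_acyclic k.+1 d) ->
  exists r' : nat, [/\ (r' <= r)%N, is_regularity v S r'%:Z
    & forall g, (r'.+1 < g)%N -> forall k d, (d.+1 = k + g)%N -> toric_acyclic k d].
Proof.
move=> SE acy.
pose st0 : stage K q := @Stage K q 1 (fun=> 0%N) toric_ker.
have good0 : good_stage r st0.
  split=> [|u hu l|k d kd]; first exact: graded_submod_toric.
    by rewrite /= in u hu l *; rewrite (ord1 l); apply: toric_const.
  exact/quot_acyclic_toric/acy.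
(* [r'] ranges over the nonnegative values of shift minus index *)
pose P r' := `[< exists j i, st_s (res_stage r st0 j) i = (j + r')%N >].
have bound j i : (st_s (res_stage r st0 j) i <= r + j)%N by apply: res_stage_shift.
have P0 : exists r', P r' by exists 0%N; apply/asboolP; exists 0%N, ord0.
have Pb r' : P r' -> (r' <= r)%N.
  by move=> /asboolP[j [i e]]; have := bound j i; rewrite e; lia.
case: (ex_maxnP P0 Pb) => r' /asboolP[j0 [i0 e0]] rmax; exists r'.
have le j i : (st_s (res_stage r st0 j) i <= j + r')%N.
  have [lt|jl] := ltnP (st_s (res_stage r st0 j) i) j.
    by apply: leq_trans (ltnW lt) (leq_addr _ _).
  have /rmax : P (st_s (res_stage r st0 j) i - j)%N.
    by apply/asboolP; exists j, i; rewrite subnKC.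
  by rewrite leq_subLR.
split; first by apply: Pb; apply/asboolP; exists j0, i0.
  pose F := @FreeComplex K n q (fun j => st_rk (res_stage r st0 j)) (fun j => st_s (res_stage r st0 j))
    (fun=> 1) (res_map r st0).
  exists F; split=> [|| j i]; first split.
  - split=> [i|j i k nz]; first by exists 1; rewrite scale1r expr0.
    have [hG _ _ _ _] := res_stage_step (res_stage_good good0 j).
    have [mu mun] : exists mu, (diff F j i k)@_mu != 0.
      apply: contrapT => h; case/eqP: nz; apply/mpolyP => mu; rewrite mcoeff0.
      by apply/eqP; apply: contrapT => /negP nz; apply: h; exists mu.
    exists (mdeg mu); first exact: esym (hG _ _ _ mun).
    apply/dhomogP => m; rewrite mcoeff_msupp => /hG e.
    exact: (addnI (etrans e (esym (hG _ _ _ mun)))).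
  - have aE (u : 'rV[T]_(rk F 0)) : augment v u = toric (u 0 (0 : 'I_1)).
      by rewrite /augment /= big_ord1 mulr1.
    split=> [f|u|j u].
    + rewrite SE; split=> [[p <-]|[u <-]]; last by exists (u 0 0); rewrite aE.
      by exists (\row_(l < 1) p : 'rV[T]_(rk F 0)); rewrite aE mxE.
    + have [_ _ ZE _ _] := res_stage_step (res_stage_good good0 0).
      by rewrite aE; apply: ZE.
    + have [_ _ _ Zj _] := res_stage_step (res_stage_good good0 j).
      have [_ _ ZE _ _] := res_stage_step (res_stage_good good0 j.+1).
      by have := ZE u; rewrite /= Zj.
  - move=> j i k; have [_ pZ _] := res_stage_good good0 j.
    have [_ _ ZE _ _] := res_stage_step (res_stage_good good0 j).
    have /pZ/(_ k) : st_Z (res_stage r st0 j) (row i (res_map r st0 j)).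
      by apply/ZE; exists (delta_mx 0 i); rewrite -rowE.
    by rewrite mxE.
  - by exists j0, i0; rewrite /= e0; lia.
  - by have := le j i; rewrite /=; lia.
move=> g r'g k d e; apply/quot_acyclic_toric.
apply: (quot_acyclic_of_shifts good0 (g := g)) (0%N) _ _; last by rewrite addn0.
by move=> j i; have := le j i; lia.
Qed.

End ToricRegularity.

(** * Hall marriage theorem *)

Section Hall.
Local Open Scope nat_scope.

(** Induction on [#|A|], following Halmos and Vaughan: either some proper
    subset has no spare neighbour, and then it is matched first, the rest of
    [A] still satisfying the condition with the remaining neighbours; or every
    proper subset has one, and any vertex may be matched arbitrarily. *)
Lemma hall_marriage (V : finType) (A : {set V}) (N : V -> {set V}) :
  (forall S : {set V}, S \subset A -> #|S| <= #|\bigcup_(x in S) N x|) ->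
  exists f : V -> V, {in A &, injective f} /\ {in A, forall x, f x \in N x}.
Proof.
have [k] := ubnP #|A|; elim: k A N => // k IH A N Ak hN.
have [->|A0] := eqVneq A set0.
  by exists id; split=> [x y|x]; rewrite inE.
have [/existsP[S /and4P[S0 SA SnA /eqP tight]]|/existsPn slack] :=
  boolP [exists S : {set V}, [&& S != set0, S \subset A, S != A & #|\bigcup_(x in S) N x| == #|S|]].
- have SpA : S \proper A by rewrite properEneq SnA.
  have [|T TS|f [fi fN]] := IH S N.
  + by have := proper_card SpA; lia.
  + by apply: hN; apply: subset_trans TS SA.
  pose NS := \bigcup_(x in S) N x.
  have [|T TD|f' [fi' fN']] := IH (A :\: S) (fun x => N x :\: NS).
  + by move: S0; rewrite -card_gt0 (cardsDS SA); have := proper_card SpA; lia.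
  + have disj : [disjoint T & S].
      by rewrite disjoint_subset; apply/subsetP => x /(subsetP TD); rewrite !inE => /andP[].
    have TA : T :|: S \subset A.
      by rewrite subUset SA andbT; apply: subset_trans TD (subsetDl _ _).
    have := hN _ TA; rewrite bigcup_setU /= -/NS cardsU disjoint_setI0 // cards0 subn0.
    rewrite -tight -/NS -(cardsID NS (_ :|: _)).
    have -> : (\bigcup_(x in T) N x :|: NS) :&: NS = NS by apply/setIidPr; apply: subsetUr.
    have -> : (\bigcup_(x in T) N x :|: NS) :\: NS = \bigcup_(x in T) (N x :\: NS).
      rewrite setDUl setDv setU0; apply/setP => y; rewrite !inE.
      apply/andP/bigcupP => [[yS /bigcupP[x xT yN]]|[x xT]].
        by exists x => //; rewrite inE yS.
      by rewrite inE => /andP[-> yN]; split=> //; apply/bigcupP; exists x.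
    by lia.
  have out x : x \in A -> x \notin S -> f' x \notin NS /\ f' x \in N x.
    by move=> xA xS; have := fN' x; rewrite !inE xS xA => /(_ isT)/andP[-> ->].
  have ins x : x \in S -> f x \in NS by move=> xS; apply/bigcupP; exists x => //; apply: fN.
  exists (fun x => if x \in S then f x else f' x); split=> [x y xA yA|x xA]; last first.
    by case: ifPn => xS; [apply: fN|case: (out x xA xS)].
  case: ifPn => xS; case: ifPn => yS.
  + exact: fi.
  + by move=> e; have := ins x xS; rewrite e (negbTE (out y yA yS).1).
  + by move=> e; have := ins y yS; rewrite -e (negbTE (out x xA xS).1).
  + by apply: fi'; rewrite inE ?xS ?yS.
have [x xA] := set0Pn _ A0.
have [y yN] : exists y, y \in N x.
  apply/set0Pn; have := hN [set x]; rewrite sub1set xA cards1 big_set1 => /(_ isT).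
  by rewrite card_gt0.
have [|T TA|f [fi fN]] := IH (A :\ x) (fun z => N z :\ y).
- by move: Ak; rewrite (cardsD1 x A) xA.
- have [->|T0] := eqVneq T set0; first by rewrite cards0.
  have TsA : T \subset A by apply: subset_trans TA (subsetDl _ _).
  have := slack T; rewrite T0 TsA /= negb_and negbK => /orP[/eqP TA'|ne].
    by have := subsetP TA x; rewrite TA' xA !inE eqxx => /(_ isT).
  have -> : \bigcup_(z in T) (N z :\ y) = (\bigcup_(z in T) N z) :\ y.
    apply/setP => u; rewrite !inE; apply/bigcupP/andP => [[z zT]|[uy /bigcupP[z zT uN]]].
      by rewrite !inE => /andP[-> uN]; split=> //; apply/bigcupP; exists z.
    by exists z; rewrite // !inE uy.
  have := hN T TsA; rewrite leq_eqVlt eq_sym (negbTE ne) /=.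
  by have := cardsD1 y (\bigcup_(z in T) N z); case: (y \in _) => /=; lia.
exists (fun z => if z == x then y else f z); split=> [z w zA wA|z zA].
  have nf u : u \in A -> u != x -> f u != y.
    by move=> uA ux; have := fN u; rewrite !inE ux uA => /(_ isT)/andP[].
  have [->|zx] := eqVneq z x; have [->|wx] := eqVneq w x => // e.
  - by have := nf w wA wx; rewrite -e eqxx.
  - by have := nf z zA zx; rewrite e eqxx.
  - by apply: fi e; rewrite !inE ?zx ?wx.
have [->//|zx] := eqVneq z x.
by have := fN z; rewrite !inE zx zA => /(_ isT)/andP[].
Qed.

End Hall.

(** * Blockers of matched graphs *)

(** The toric map is the substitution of the generators in polynomials. *)
Lemma edge_subringP (K : fieldType) n (B : {set {set 'I_n}}) f :
  edge_subring K B f <-> exists p, toric_map (@clutter_col n B) p = f.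
Proof.
split=> [|[p <-]].
  elim=> {f} [f [j ->]|c|f g _ [p <-] _ [p' <-]|f g _ [p <-] _ [p' <-]].
  - exists 'X_j; rewrite toricX mdeg1; congr (xt_mon _ _ _).
    apply/mnmP => x; rewrite mnmE (bigD1 j) //= mnm1E eqxx muln1 big1 ?addn0 // => i.
    by rewrite mnm1E eq_sym => /negbTE ->; rewrite muln0.
  - by exists c%:MP; rewrite toricC.
  - by exists (p + p'); rewrite rmorphD.
  - by exists (p * p'); rewrite rmorphM.
pose F (f : {poly {mpoly K[n]}}) := exists j : 'I_#|B|, f = xt_mon K (clutter_col B j) 1.
have edge1 : edge_subring K B 1 by have := subalg_const F 1; rewrite !rmorph1.
rewrite {1}(mpolyE p) rmorph_sum /=.
elim/big_ind: _ => [|g h|m _]; [|exact: subalg_add|].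
  by have := subalg_const F 0; rewrite !raddf0.
rewrite /toric_map mmapZ mmapX; apply: subalg_mul; first exact: subalg_const.
rewrite /mmap1; elim/big_ind: _ => // [|i _]; first exact: subalg_mul.
elim: (m i) => [|k IH]; first by rewrite expr0.
by rewrite exprS; apply: subalg_mul => //; apply: subalg_gen; exists i.
Qed.

(** A bipartite graph with a perfect matching [mu] such that all minimal
    covers contain exactly one end of each matched edge. The matching is a
    parameter in order to treat at once a matching given by Hall's theorem and
    an explicit one. *)
Section MatchedGraph.
Variables (n : nat) (G : {set {set 'I_n}}) (X : {set 'I_n}) (mu : 'I_n -> 'I_n).
Hypothesis GX : forall e, e \in G -> exists x y, [/\ x \in X, y \notin X & e = [set x; y]].
Hypothesis muX : forall x, (mu x \in X) = (x \notin X).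
Hypothesis muK : involutive mu.
Hypothesis muG : forall x, x \in X -> [set x; mu x] \in G.
Hypothesis mu_compl : forall D x, D \in blocker G -> (mu x \in D) = (x \notin D).

Let r : rel 'I_n := fun x w => [set x; mu w] \in G.
Let C (j : 'I_#|blocker G|) : {set 'I_n} := enum_val j.
Let cp := cover_point C.
Let gp := gen_point (@clutter_col n (blocker G)).

Lemma blockerP (D : {set 'I_n}) : reflect (vertex_cover G D /\ forall E, vertex_cover G E -> E \subset D -> E = D)
  (D \in blocker G).
Proof. by rewrite inE; apply: minsetP. Qed.

Lemma coverP (D : {set 'I_n}) : reflect (forall e, e \in G -> exists2 x, x \in D & x \in e) (vertex_cover G D).
Proof.
apply: (iffP forall_inP) => h e /h; first by case/set0Pn => x; rewrite inE => /andP[]; exists x.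
by case=> x xD xe; apply/set0Pn; exists x; rewrite inE xD.
Qed.

Lemma mu_edge x : [set x; mu x] \in G.
Proof.
have [/muG//|xX] := boolP (x \in X).
by rewrite setUC -{2}[x]muK; apply: muG; rewrite muX.
Qed.

(** A set with exactly one end of each matched edge is minimal as soon as it
    is a cover, since removing a vertex uncovers its matched edge; and the
    covering condition of the edge from [x] to [y] is closedness for [r x (mu
    y)]. *)
Lemma good_coverE (D : {set 'I_n}) : good_cover X mu r D = (D \in blocker G).
Proof.
apply/andP/blockerP => [[/downsetP dD /forallP oD]|].
  have mE x : (mu x \in D) = (x \notin D) by apply/eqP.
  split.
    apply/coverP => e eG; have [x [y [xX yX exy]]] := GX eG.
    have [xD|xD] := boolP (x \in D); first by exists x; rewrite // exy !inE eqxx.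
    exists y; last by rewrite exy !inE eqxx orbT.
    rewrite -[y]muK mE; apply: contra xD => wD.
    have wX : mu y \in X by rewrite muX.
    have := dD x (mu y) xX wX; rewrite /r muK -exy eG !inE wD wX => /(_ isT isT).
    by case/andP.
  move=> E /coverP cE ED; apply/eqP; rewrite eqEsubset ED; apply/subsetP => x xD.
  have [y yE] := cE _ (mu_edge x); rewrite !inE => /orP[/eqP <-//|/eqP ymu].
  by have := subsetP ED _ yE; rewrite ymu mE xD.
move=> hD; have Db : D \in blocker G by apply/blockerP.
case: hD => /coverP cD _; split; last by apply/forallP => x; rewrite mu_compl.
apply/downsetP => x w xX wX rxw; rewrite !inE xX wX !andbT => wD.
have [y yD] := cD _ rxw; rewrite !inE => /orP[/eqP <-//|/eqP ymu].
by rewrite ymu mu_compl // wD in yD.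
Qed.

Lemma C_good j : good_cover X mu r (C j).
Proof. by rewrite good_coverE; apply: enum_valP. Qed.

Lemma C_all (E : {set 'I_n}) : good_cover X mu r E -> exists j, C j = E.
Proof. by rewrite good_coverE => h; exists (enum_rank_in h E); apply: enum_rankK_in. Qed.

Lemma C_inj : injective C. Proof. exact: enum_val_inj. Qed.

Lemma gen_point_cover : gp = cp.
Proof.
apply: funext => j; congr (_, _); apply/ffunP => x.
by rewrite !ffunE mnmE mxE.
Qed.

Local Notation cone := (cone X mu r).
Local Notation mpB := (mon_point (@clutter_col n (blocker G))).

Lemma cone0 : cone 0.
Proof.
by apply/coneP; split=> // *; rewrite /coord !ffunE.
Qed.

Lemma mon_point0 : mpB 0%MM = 0.
Proof.
congr (_, _); last by rewrite mdeg0.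
apply/ffunP => x; rewrite !ffunE mnmE big1 // => j _.
by rewrite mnm0E muln0.
Qed.

(** By [cone_decompose], a point of level [d] of the cone is the sum of [d]
    covers. *)
Lemma coneE ga : cone ga <-> exists m, mpB m = ga.
Proof.
split.
  move=> c; have : exists d : nat, tdeg ga = d%:Z.
    by exists `|tdeg ga|%N; rewrite gez0_abs //; have /coneP/cone_ge0 := c.
  case=> d; elim: d ga c => [|d IH] ga c ed.
    exists 0%MM; rewrite mon_point0 [ga]surjective_pairing -/(tdeg ga) ed; congr (_, _).
    apply/ffunP => x; rewrite !ffunE; have /coneP cs := c.
    suff : coord ga x = 0 by rewrite /coord => ->.
    by have := cone_pos cs x; have := cone_le x cs; rewrite ed; lia.
  have [|z cz] := cone_decompose muX muK C_all c; first by rewrite ed.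
  have [|m em] := IH _ cz; first by rewrite tdegD tdegN tdeg_cover_point ed; lia.
  by exists (U_(z) + m)%MM; rewrite mon_pointD -/gp gen_point_cover em subrK.
case=> m <-; have [d] := ubnP (mdeg m); elim: d m => // d IH m md.
have [->|m0] := eqVneq m 0%MM; first by rewrite mon_point0 cone0.
have [j mj] : exists j, (0 < m j)%N.
  apply: contrapT => h; case/eqP: m0; apply/mnmP => j; rewrite mnm0E.
  by apply/eqP; rewrite -leqn0 leqNgt; apply/negP => mj; apply: h; exists j.
have em : m = (U_(j) + (m - U_(j)))%MM.
  by rewrite addmC submK //; apply/mnm_lepP => i; rewrite mnm1E; case: eqP => [<-|].
rewrite em mon_pointD -/gp gen_point_cover; apply/coneP/(cone_add C_good)/coneP/IH.
by move: md; rewrite {1}em mdegD mdeg1; lia.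
Qed.

Lemma clutter_colE j x : clutter_col (blocker G) j x = (x \in C j :> nat).
Proof. by rewrite mnmE mxE. Qed.

(** The equalities and inequalities of the cone are satisfied by the covers,
    hence by their convex combinations and dilations, so the lattice points of
    the multiples of the polytope are points of the cone. *)
Lemma ehrhart_image (R : realType) (K : fieldType) f :
  edge_subring K (blocker G) f <-> ehrhart_ring K (clutter_polytope R (blocker G)) f.
Proof.
split; elim=> {f} [f|c|f g _ Hf _ Hg|f g _ Hf _ Hg]; try by [exact: subalg_const|exact: subalg_add|exact: subalg_mul].
  case=> j ->; apply: subalg_gen; exists (clutter_col (blocker G) j), 1%N; split=> //.
  exists (real_vec R (clutter_col (blocker G) j)); last by rewrite scale1r.
  exists (fun i => (i == j)%:R); split=> [i||]; first exact: ler0n.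
    by rewrite (bigD1 j) //= eqxx big1 ?addr0 // => i /negbTE ->.
  by rewrite (bigD1 j) //= eqxx scale1r big1 ?addr0 // => i /negbTE ->; rewrite scale0r.
case=> a [b [[p [l [l0 l1 ->]] eab] ->]].
have ax x : (a x)%:R = b%:R * \sum_j l j * (x \in C j)%:R.
  have := congr1 (fun u : 'rV[R]_n => u 0 x) eab; rewrite !mxE summxE => ->.
  by congr (_ * _); apply: eq_bigr => j _; rewrite !mxE clutter_colE.
have : cone ([ffun x => (a x)%:Z], b%:Z).
  apply/coneP; split=> [//|x|x|x w xX wX rxw]; rewrite /coord /tdeg /= ?ffunE //.
    rewrite -PoszD; congr Posz; apply/eqP; rewrite -(eqr_nat R) natrD !ax -mulrDr -big_split /=.
    rewrite (eq_bigr l) ?l1 ?mulr1 // => j _; rewrite -mulrDr.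
    by rewrite (C_mu C_good); case: (x \in C j); rewrite ?addr0 ?add0r mulr1.
  rewrite lez_nat -(ler_nat R) !ax; apply: ler_wpM2l; first exact: ler0n.
  apply: ler_sum => j _; apply: ler_wpM2l => //; rewrite ler_nat.
  have := C_down C_good (j := j) xX wX rxw.
  by case: (w \in C j) => [/(_ isT) ->|].
move=> /coneE[m em]; apply/edge_subringP; exists 'X_[m]; rewrite toricX.
have e1 := congr1 (fun g : point n => g.1) em.
have -> : mdeg m = b := congr1 (fun g : point n => `|g.2|%N) em.
congr (xt_mon _ _ _); apply/mnmP => x.
by have /ffunP/(_ x) := e1; rewrite !ffunE => -[].
Qed.

Lemma blocker_clutter : is_clutter (blocker G).
Proof. by move=> e f /blockerP[ce _] /blockerP[_ mf] ef; apply: mf. Qed.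

Lemma card_matched (D : {set 'I_n}) : (forall x, (mu x \in D) = (x \notin D)) -> #|D| = #|X|.
Proof.
move=> oD; rewrite -(cardsID X D) -(cardsID D X) setIC; congr (_ + _)%N.
have -> : D :\: X = mu @: (X :\: D).
  apply/setP => y; rewrite inE; apply/andP/imsetP => [[yX yD]|[x]].
    by exists (mu y); rewrite ?muK // inE muX oD yX yD.
  by rewrite inE => /andP[xD xX] ->; rewrite muX oD xX xD.
by rewrite card_imset //; apply: can_inj muK.
Qed.

Lemma card_2X : n = (#|X| + #|X|)%N.
Proof.
rewrite -{1}[n]card_ord -cardsT -(cardsID X setT) setTI; congr (_ + _)%N.
by rewrite setTD (card_matched (D := ~: X)) // => x; rewrite !inE muX.
Qed.

Hypothesis n0 : (0 < n)%N.

Lemma X_gt0 : (0 < #|X|)%N.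
Proof. by move: n0 card_2X; lia. Qed.

(** The bound is [face_regularity] for the whole cone. For an antichain,
    [face_not_acyclic] at homological degree [q - g - 1] excludes smaller
    values; that this number is not negative comes from the number [2 ^ g] of
    covers. *)
Lemma matched_regularity (R : realType) (K : fieldType) : exists r' : nat,
  [/\ (r' <= #|X|.-1)%N,
    is_regularity (@clutter_col n (blocker G)) (ehrhart_ring K (clutter_polytope R (blocker G))) r'%:Z
  & (forall x w, x \in X -> w \in X -> r x w -> x = w) -> r' = #|X|.-1].
Proof.
have SE f : ehrhart_ring K (clutter_polytope R (blocker G)) f <->
    exists p, toric_map (@clutter_col n (blocker G)) p = f.
  by rewrite -edge_subringP; split=> /ehrhart_image.
have acy k d : (k.+1 + #|X|.-1 < d)%N ->
   toric_acyclic K (@clutter_col n (blocker G)) k.+1 d.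
  move=> kd c hc cy; apply: (transfer coneE _ hc cy) => al dal.
  rewrite -/gp gen_point_cover; apply: (acyclic_ext (cone_face X mu r)).
  have d0 : downset X r set0 by apply/downsetP => x w _ _ _; rewrite inE.
  have [h _] := @face_regularity K n _ X mu r C muX muK C_good C_all _ set0 erefl d0 (sub0set _).
  by apply: h; rewrite setD0 dal ltz_nat.
have [r' [r'X reg low]] := toric_regularity SE acy.
exists r'; split=> // r_eq; apply/eqP; rewrite eqn_leq r'X leqNgt; apply/negP => lt.
(* distinct subsets of [X] give distinct covers, and [g < 2 ^ g] *)
have qX : (#|X| < #|blocker G|)%N.
  have /boolp.choice[f fE] : forall D : {set 'I_n}, exists z, D \subset X ->
      forall x, x \in X -> (x \in C z) = (x \in D).
    move=> D; have [DX|DX] := boolP (D \subset X).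
      have [z Cz] := exists_cover muX muK C_all (downset_all r_eq D) DX.
      by exists z => _ x xX; rewrite Cz xX.
    have [z Cz] := exists_cover muX muK C_all (downset_all r_eq X) (subxx _).
    by exists z.
  have finj : {in powerset X &, injective f}.
    move=> D E; rewrite !inE => DX EX e; apply/setP => x.
    have [xX|xX] := boolP (x \in X); first by rewrite -(fE D DX) // e (fE E EX).
    by rewrite (contraNF (subsetP DX x)) // (contraNF (subsetP EX x)).
  have := max_card (mem (f @: powerset X)); rewrite (card_in_imset finj) card_powerset card_ord.
  by apply: leq_trans; apply: ltn_expl.
pose k := (#|blocker G| - #|X|.+1)%N.
have X0 := X_gt0.
have Xm : #|X :\: set0| = #|X|.-1.+1 by rewrite setD0 prednK.
apply: (@face_not_acyclic K n _ X mu r C muX muK C_good C_all C_inj r_eq _ k set0 Xm).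
- exact: sub0set.
- by rewrite /k; lia.
move=> al dal; apply: (acyclic_ext (fun ga => esym (cone_face X mu r ga))).
rewrite -/cp -gen_point_cover; apply: (transfer_rev coneE (d := (k + #|X|).-1)) => [c hc cy|].
  by apply: (low #|X|) => //; lia.
by rewrite dal /k; lia.
Qed.

End MatchedGraph.

(** * Unmixed bipartite graphs *)

Section Unmixed.
Variables (n : nat) (G : {set {set 'I_n}}) (X : {set 'I_n}).
Hypothesis GX : forall e, e \in G -> exists x y, [/\ x \in X, y \notin X & e = [set x; y]].
Hypothesis unm : unmixed G.
Hypothesis noiso : no_isolated_vertex G.

(** Removing a vertex of a side uncovers the edges through that vertex, and
    there is at least one. *)
Lemma side_blocker (A : {set 'I_n}) :
  (forall e, e \in G -> exists x y, [/\ x \in A, y \notin A & e = [set x; y]]) ->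
  A \in blocker G.
Proof.
move=> GA; apply/blockerP; split.
  by apply/coverP => e /GA[x [y [xA _ ->]]]; exists x; rewrite // !inE eqxx.
move=> E /coverP cE EA; apply/eqP; rewrite eqEsubset EA; apply/subsetP => x xA.
have [e eG] := noiso x; have [a [b [aA bA eab]]] := GA e eG.
rewrite eab !inE => /orP[/eqP xa|/eqP xb]; last by rewrite xb (negbTE bA) in xA.
have [y yE] := cE e eG; rewrite eab !inE => /orP[/eqP ya|/eqP yb].
  by rewrite xa -ya.
by have := subsetP EA y yE; rewrite yb (negbTE bA).
Qed.

(** The set [D] in the proof of Hall's condition is a cover, so it contains a
    minimal one, which has the size of [X]. Then [#|X|] matched edges and a
    minimal cover of the same size leave room for exactly one end of each. *)
Lemma unmixed_matching : exists mu : 'I_n -> 'I_n,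
  [/\ forall x, (mu x \in X) = (x \notin X), involutive mu,
      forall x, x \in X -> [set x; mu x] \in G
    & forall (D : {set 'I_n}) x, D \in blocker G -> (mu x \in D) = (x \notin D)].
Proof.
have bX : X \in blocker G by apply: side_blocker.
have bXC : ~: X \in blocker G.
  apply: side_blocker => e /GX[x [y [xX yX ->]]]; exists y, x.
  by rewrite !inE negbK yX xX setUC.
pose N x := [set y | [set x; y] \in G].
have [S SX|f [fi fN]] := @hall_marriage _ X N.
  (* the cover that turns the size of minimal covers into Hall's condition *)
  pose D := (X :\: S) :|: \bigcup_(x in S) N x.
  have cD : vertex_cover G D.
    apply/coverP => e eG; have [x [y [xX yX exy]]] := GX eG.
    have [xS|xS] := boolP (x \in S).
      exists y; last by rewrite exy !inE eqxx orbT.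
      by apply/setUP; right; apply/bigcupP; exists x; rewrite // inE -exy.
    by exists x; [rewrite !inE xS xX|rewrite exy !inE eqxx].
  have [B mB BD] := minset_exists cD.
  have cB : #|X| = #|B| by apply: unm; rewrite // inE.
  have := subset_leq_card BD; rewrite -cB /D cardsU.
  have := cardsID S X; rewrite (setIidPr SX); lia.
have fG x : x \in X -> [set x; f x] \in G by move=> /fN; rewrite inE.
have fX x : x \in X -> f x \notin X.
  move=> xX; have [a [b [aX bX' eab]]] := GX (fG x xX).
  have : b \in [set x; f x] by rewrite eab !inE eqxx orbT.
  by rewrite !inE => /orP[/eqP bx|/eqP <- //]; rewrite bx xX in bX'.
have fim : f @: X = ~: X.
  apply/eqP; rewrite eqEcard card_in_imset // (unm bXC bX) leqnn andbT.
  by apply/subsetP => y /imsetP[x xX ->]; rewrite inE fX.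
pose mu x := if x \in X then f x else odflt x [pick y in X | f y == x].
have muXC x : x \notin X -> mu x \in X /\ f (mu x) = x.
  move=> xX; rewrite /mu (negbTE xX); case: pickP => [y /andP[yX /eqP]|h] //=.
  have : x \in f @: X by rewrite fim inE.
  by case/imsetP => y yX exy; have := h y; rewrite yX exy eqxx.
have muX x : (mu x \in X) = (x \notin X).
  have [xX|xX] /= := boolP (x \in X); last by have [->] := muXC x xX.
  by rewrite /mu xX; apply/negbTE/fX.
have muK : involutive mu.
  move=> x; have [xX|xX] := boolP (x \in X).
    have fxX := fX x xX; have [h1 h2] := muXC _ fxX.
    have -> : mu x = f x by rewrite /mu xX.
    exact: fi.
  by have [h1 h2] := muXC x xX; rewrite {1}/mu h1.
have muG x : x \in X -> [set x; mu x] \in G by move=> xX; rewrite /mu xX; apply: fG.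
exists mu; split=> // D.
suff oX x : D \in blocker G -> x \in X -> (mu x \in D) = (x \notin D).
  move=> x bD; have [xX|xX] := boolP (x \in X); first exact: oX.
  by have := oX (mu x) bD; rewrite muX muK => /(_ xX) ->; rewrite negbK.
move=> bD xX; pose P2 := [set y in X | mu y \in D].
have PU : X = (X :&: D) :|: P2.
  apply/setP => y; rewrite !inE; case: (boolP (y \in X)) => //= yX.
  have /blockerP[/coverP cD _] := bD.
  have [z zD] := cD _ (muG y yX); rewrite !inE => /orP[/eqP <-|/eqP <-]; by rewrite zD ?orbT.
have cP2 : #|P2| = #|D :\: X|.
  have -> : D :\: X = mu @: P2.
    apply/setP => y; rewrite inE; apply/andP/imsetP => [[yX yD]|[z]].
      by exists (mu y); rewrite ?muK // !inE muX yX muK.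
    by rewrite inE => /andP[zX zD] ->; rewrite muX zX zD.
  by rewrite card_imset //; apply: can_inj muK.
(* both ends in [D] would make [#|D|] larger than [#|X|] *)
have PI : (X :&: D) :&: P2 = set0.
  apply/eqP; rewrite -cards_eq0.
  have := cardsU (X :&: D) P2; rewrite -PU cP2 (unm bX bD) -(cardsID X D) (setIC D X).
  have := subset_leq_card (subsetIl (X :&: D) P2); lia.
have [xD|xD] := boolP (x \in D).
  have := in_set0 x; rewrite -PI !inE xX xD /=.
  by move=> ->.
have : x \in (X :&: D) :|: P2 by rewrite -PU.
by rewrite !inE (negbTE xD) andbF xX.
Qed.

End Unmixed.

Section PerfectMatching.
Variable n : nat.
Hypothesis n_even : ~~ odd n.

Let X : {set 'I_n} := [set i : 'I_n | (i < n./2)%N].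

(** The vertices [i] and [n - 1 - i] are joined; the blocker consists of all
    choices of one end for each edge, and the toric ring is the Segre product
    of [n/2] polynomial rings in two variables. *)
Definition perfect_matching : {set {set 'I_n}} := [set [set x; rev_ord x] | x in X].
Local Notation G := perfect_matching.

Lemma rev_X x : (rev_ord x \in X) = (x \notin X).
Proof.
rewrite !inE /=; have := ltn_ord x; have := odd_double_half n.
by rewrite (negbTE n_even) -addnn; lia.
Qed.

Lemma rev_neq x : rev_ord x != x :> 'I_n.
Proof. by apply/eqP => e; have := rev_X x; rewrite e; case: (x \in X). Qed.

Lemma matching_sides e : e \in G -> exists x y, [/\ x \in X, y \notin X & e = [set x; y]].
Proof.
by case/imsetP => x xX ->; exists x, (rev_ord x); rewrite rev_X xX.
Qed.

Lemma matching_edge x : [set x; rev_ord x] \in G.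
Proof.
have [xX|xX] := boolP (x \in X); first exact: imset_f.
by apply/imsetP; exists (rev_ord x); rewrite ?rev_X // rev_ordK setUC.
Qed.

Lemma matching_one (D : {set 'I_n}) x : D \in blocker G -> (rev_ord x \in D) = (x \notin D).
Proof.
move=> /blockerP[/coverP cD minD]; have [xD|xD] /= := boolP (x \in D); last first.
  have [y yD] := cD _ (matching_edge x); rewrite !inE => /orP[/eqP yx|/eqP <- //].
  by rewrite yx (negbTE xD) in yD.
apply/negbTE/negP => rD.
have /minD : vertex_cover G (D :\ x).
  apply/coverP => e eG; have [ex|ex] := eqVneq e [set x; rev_ord x].
    by exists (rev_ord x); rewrite ?ex !inE ?eqxx ?orbT // rev_neq.
  have [y yD ye] := cD e eG; exists y => //; rewrite !inE yD andbT.
  apply: contraNneq ex => yx; move: eG ye; rewrite yx => /imsetP[z _ ->].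
  by rewrite !inE => /orP[/eqP ->|/eqP ->]; rewrite ?eqxx // rev_ordK setUC.
by move=> /(_ (subsetDl _ _)) e; move: xD; rewrite -e !inE eqxx.
Qed.

Lemma matching_antichain x w : x \in X -> w \in X -> [set x; rev_ord w] \in G -> x = w.
Proof.
move=> xX wX /imsetP[z zX e].
have : x \in [set z; rev_ord z] by rewrite -e !inE eqxx.
rewrite !inE => /orP[/eqP xz|/eqP xz]; last by have := rev_X z; rewrite -xz xX zX.
have : rev_ord w \in [set z; rev_ord z] by rewrite -e !inE eqxx orbT.
rewrite !inE => /orP[/eqP wz|/eqP/rev_ord_inj ->//].
by have := rev_X w; rewrite wz zX wX.
Qed.

End PerfectMatching.

Theorem corollary2p4 (R : realType) (K : fieldType) (n : nat) (n_gt0 : (0 < n)%N) :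
  (forall G : {set {set 'I_n}},
     is_graph G -> bipartite G -> unmixed G -> no_isolated_vertex G ->
     ehrhart_clutter R K (blocker G) /\
     exists r : int,
       is_regularity (clutter_col (blocker G))
         (ehrhart_ring K (clutter_polytope R (blocker G))) r /\
       (r%:~R : rat) <= n%:R / 2%:R - 1) /\
  (~~ odd n ->
   exists G : {set {set 'I_n}},
     [/\ is_graph G, bipartite G, unmixed G & no_isolated_vertex G] /\
     exists r : int,
       is_regularity (clutter_col (blocker G))
         (ehrhart_ring K (clutter_polytope R (blocker G))) r /\
       (r%:~R : rat) = n%:R / 2%:R - 1).
Proof.
have half (X : {set 'I_n}) : n = (#|X| + #|X|)%N -> (n%:R / 2%:R - 1 : rat) = (#|X|.-1)%:R.
  move=> e; have X0 : (0 < #|X|)%N by move: n_gt0 e; lia.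
  have -> : n%:R = #|X|%:R + #|X|%:R :> rat by rewrite -natrD -e.
  have -> : #|X|%:R = (#|X|.-1)%:R + 1 :> rat by rewrite natr1 prednK.
  by field.
split.
  move=> G _ [X GX] unm noiso.
  have [mu [muX muK muG mu_compl]] := unmixed_matching GX unm noiso.
  split.
    split; first exact: blocker_clutter.
    exact: (ehrhart_image GX muX muK muG mu_compl).
  have [r' [rX reg _]] := matched_regularity GX muX muK muG mu_compl n_gt0 R K.
  exists r'%:Z; split=> //.
  by rewrite (half X (card_2X muX muK)) -pmulrn ler_nat.
move=> ev; pose X := [set i : 'I_n | (i < n./2)%N].
have muX := rev_X ev; have muK := @rev_ordK n.
have GX := matching_sides ev; have mu_compl := matching_one ev.
have muG x : x \in X -> [set x; rev_ord x] \in perfect_matching n.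
  by move=> _; apply: matching_edge.
exists (perfect_matching n); split.
  split.
  - by move=> e /imsetP[x _ ->]; rewrite cards2 eq_sym rev_neq.
  - by exists X => e; apply: GX.
  - by move=> C D bC bD; rewrite !(card_matched muX muK) // => x; apply: mu_compl.
  - by move=> x; exists [set x; rev_ord x]; rewrite ?matching_edge // !inE eqxx.
have [r' [_ reg low]] := matched_regularity GX muX muK muG mu_compl n_gt0 R K.
exists r'%:Z; split=> //.
rewrite (half X (card_2X muX muK)) -pmulrn low // => x w.
exact: matching_antichain.
Qed.
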